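(* Let $R$ be an integral domain and let $\ast=\tilde{\ast}$ be a star operation on $R$ that is spectral and of finite type. The following conditions are equivalent: (i) $R$ is Clifford $\ast$-regular and $R^{[\ast]}$ is a Krull domain; (ii) $R$ is $\ast$-stable of $\ast$-dimension one. Under any one of these conditions, $\ast=w$ and $R^{[\ast]}=R^{[w]}=\widetilde{R}$ is the complete integral closure of $R$.
   Context: $R$ is an integral domain with field of fractions $K$. An ideal of $R$ means a nonzero fractional ideal (an integral ideal if contained in $R$); prime ideals are integral and nonzero. $\mathcal F(R)$ is the set of ideals, and $(J:I)=\{x\in K: xI\subseteq J\}$. A star operation on $R$ is a map $\mathcal F(R)\to\mathcal F(R)$, $I\mapsto I^\ast$, such that for all $0\ne a\in K$ and $I,J\in\mathcal F(R)$: $R^\ast=R$ and $(aI)^\ast=aI^\ast$; $I\subseteq I^\ast$, and $I\subseteq J$ implies $I^\ast\subseteq J^\ast$; $I^{\ast\ast}=I^\ast$. It is of finite type if $I^\ast=\bigcup\{J^\ast: J\subseteq I,\ J \text{ a finitely generated ideal}\}$ for all $I$. $I$ is a $\ast$-ideal if $I=I^\ast$; a $\ast$-prime is a prime ideal that is a $\ast$-ideal; a $\ast$-maximal ideal is a maximal element of the set of proper integral $\ast$-ideals; $\ast\text{-Max}(R)$ is the set of $\ast$-maximal ideals. For $\ast$ of finite type, $\tilde{\ast}$ is the star operation $I\mapsto\bigcap_{M\in\ast\text{-Max}(R)}IR_M$; one has $\ast=\tilde\ast$ exactly when $\ast$ is spectral (i.e. $I^\ast=\bigcap_{P\in\mathcal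 G}IR_P$ for some family $\mathcal G$ of pairwise incomparable primes with $R=\bigcap_{P\in\mathcal G}R_P$) and of finite type. $I^v=(R:(R:I))$, $I^t=\bigcup\{J^v: J\subseteq I \text{ a finitely generated ideal}\}$, and $w=\tilde t$. $R$ is Clifford $\ast$-regular if for every ideal $I$ of $R$ there is an ideal $J$ of $R$ with $I^\ast=(I^2J)^\ast$. An ideal $I$ is $\ast$-stable if, with $E:=(I^\ast:I^\ast)$, one has $(I^\ast(E:I^\ast))^\ast=E$; $R$ is $\ast$-stable if every ideal is $\ast$-stable. $R$ has $\ast$-dimension one if each $\ast$-prime ideal has height one. The $\ast$-integral closure is $R^{[\ast]}=\bigcup\{(J^\ast:J^\ast): J \text{ a finitely generated ideal of } R\}$ and the complete integral closure is $\widetilde R=\bigcup\{(I^v:I^v): I \text{ an ideal of } R\}$. *)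

(* Defs.v *)
From mathcomp Require Import all_boot all_order all_algebra.
From mathcomp Require Import all_classical.
Set Implicit Arguments.
Unset Strict Implicit.
Unset Printing Implicit Defensive.
Import Order.TTheory GRing.Theory Num.Theory.
Local Open Scope classical_set_scope.
Local Open Scope ring_scope.

(* An integral domain is handled through its image A in a field K; [base_ring]
   gives the image of a domain R in its field of fractions. Ideals, overrings
   and localizations are all subsets of K. *)
Definition base_ring (R : idomainType) : set {fraction R} :=
  range (@FracField.tofrac R).

Arguments base_ring R : clear implicits.

Section Ideals.
Variables (K : fieldType) (A : set K).
Implicit Types (I J P : set K) (star : set K -> set K).

Definition submodule I : Prop :=
  [/\ I 0, (forall x y, I x -> I y -> I (x + y))
    & (forall a x, A a -> I x -> I (a * x))].

(* Ideals are nonzero fractional ideals. *)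
Definition ideal I : Prop :=
  [/\ submodule I, (exists2 x, I x & x != 0)
    & (exists d, [/\ A d, d != 0 & forall x, I x -> A (d * x)])].

Definition fg_ideal I : Prop :=
  ideal I /\ exists (n : nat) (g : 'I_n -> K),
    I = [set x | exists2 c : 'I_n -> K,
           (forall i, A (c i)) & x = \sum_(i < n) c i * g i].

Definition ideal_mul I J : set K :=
  [set x | exists (n : nat) (a b : 'I_n -> K),
     [/\ (forall i, I (a i)), (forall i, J (b i))
       & x = \sum_(i < n) a i * b i]].

(* (J : I) *)
Definition colon J I : set K := [set x | forall y, I y -> J (x * y)].

(* Prime ideals of A, the zero ideal included: needed for heights only. *)
Definition spec_prime P : Prop :=
  [/\ submodule P, P `<=` A, P <> A
    & forall x y, A x -> A y -> P (x * y) -> P x \/ P y].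

Definition prime_ideal P : Prop := ideal P /\ spec_prime P.

(* A chain C 0 < ... < C n = P in Spec A. *)
Definition prime_chain P (n : nat) (C : nat -> set K) : Prop :=
  [/\ (forall i, (i <= n)%N -> spec_prime (C i)),
      (forall i, (i < n)%N -> C i `<=` C i.+1 /\ C i <> C i.+1)
    & C n = P].

Definition has_height P (n : nat) : Prop :=
  (exists C, prime_chain P n C) /\
  (forall m C, prime_chain P m C -> (m <= n)%N).

Definition localization P : set K :=
  [set x | exists a s, [/\ A a, A s, ~ P s & x = a / s]].

Definition extend I P : set K := ideal_mul I (localization P).

Record star_operation star : Prop := StarOperation {
  star_ideal_closed : forall I, ideal I -> ideal (star I);
  star_ring : star A = A;
  star_scale : forall (a : K) I, a != 0 -> ideal I ->
    star [set a * x | x in I] = [set a * x | x in star I];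
  star_extensive : forall I, ideal I -> I `<=` star I;
  star_monotone : forall I J, ideal I -> ideal J ->
    I `<=` J -> star I `<=` star J;
  star_idempotent : forall I, ideal I -> star (star I) = star I
}.

Definition finite_type star : Prop :=
  forall I, ideal I ->
    star I = \bigcup_(J in [set J | fg_ideal J /\ J `<=` I]) star J.

Definition is_star_ideal star I : Prop := ideal I /\ star I = I.

Definition star_prime star P : Prop := prime_ideal P /\ is_star_ideal star P.

Definition proper_integral_star_ideal star I : Prop :=
  [/\ is_star_ideal star I, I `<=` A & I <> A].

Definition star_max star : set (set K) :=
  [set M | proper_integral_star_ideal star M /\
     forall I, proper_integral_star_ideal star I -> M `<=` I -> I = M].

Definition star_tilde star I : set K :=
  \bigcap_(M in star_max star) extend I M.

Definition spectral star : Prop :=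
  exists G : set (set K),
    [/\ (forall P, G P -> prime_ideal P),
        (forall P Q, G P -> G Q -> P `<=` Q -> P = Q),
        A = \bigcap_(P in G) localization P
      & forall I, ideal I -> star I = \bigcap_(P in G) extend I P].

(* Two star operations are equal when they agree on all ideals; their values
   on other subsets of K are irrelevant. *)
Definition star_eq star star' : Prop := forall I, ideal I -> star I = star' I.

Definition v_op I : set K := colon A (colon A I).

Definition t_op I : set K :=
  \bigcup_(J in [set J | fg_ideal J /\ J `<=` I]) v_op J.

Definition w_op : set K -> set K := star_tilde t_op.

Definition clifford_star_regular star : Prop :=
  forall I, ideal I -> exists2 J, ideal J &
    star I = star (ideal_mul (ideal_mul I I) J).

Definition star_stable_ideal star I : Prop :=
  let E := colon (star I) (star I) in
  star (ideal_mul (star I) (colon E (star I))) = E.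

Definition star_stable star : Prop :=
  forall I, ideal I -> star_stable_ideal star I.

Definition star_dimension_one star : Prop :=
  forall P, star_prime star P -> has_height P 1.

Definition star_integral_closure star : set K :=
  \bigcup_(J in fg_ideal) colon (star J) (star J).

Definition complete_integral_closure : set K :=
  \bigcup_(I in ideal) colon (v_op I) (v_op I).

End Ideals.

Section Krull.
Variable K : fieldType.

(* A normalized discrete valuation; the value [v 0] plays no role. *)
Definition discrete_valuation (v : K -> int) : Prop :=
  [/\ (forall x y, x != 0 -> y != 0 -> v (x * y) = v x + v y),
      (forall x y, x != 0 -> y != 0 -> x + y != 0 ->
         Order.min (v x) (v y) <= v (x + y))
    & (forall n : int, exists2 x, x != 0 & v x = n)].

Definition valuation_ring (v : K -> int) : set K :=
  [set x | x = 0 \/ 0 <= v x].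

Definition subring (B : set K) : Prop :=
  [/\ B 1, (forall x y, B x -> B y -> B (x - y))
    & (forall x y, B x -> B y -> B (x * y))].

(* B is a Krull domain with field of fractions K: the intersection of a family
   of discrete valuation rings of K with finite character. The empty family is
   allowed, so that K itself is a Krull domain. *)
Definition krull_domain (B : set K) : Prop :=
  [/\ subring B,
      (forall x, exists a b, [/\ B a, B b, b != 0 & x = a / b])
    & exists (L : Type) (v : L -> K -> int),
        [/\ (forall l, discrete_valuation (v l)),
            B = \bigcap_l valuation_ring (v l)
          & forall x, x != 0 -> finite_set [set l | v l x != 0]]].

End Krull.

(* Main.v *)
Require Import Defs.
From mathcomp Require Import all_boot all_order all_fingroup all_algebra.
From mathcomp Require Import all_classical.
From mathcomp Require Import ring zify.
Set Implicit Arguments.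
Unset Strict Implicit.
Unset Printing Implicit Defensive.
Import Order.TTheory GRing.Theory Num.Theory.
Local Open Scope classical_set_scope.
Local Open Scope ring_scope.

(** As star is spectral, an equality of star ideals can be tested in the
    localizations [R_M], [M] star-maximal.  Write [D] for the star-integral
    closure and [D_M] for its localization, the integral closure of [R_M].
    A determinant trick shows that under Clifford regularity (which stability
    implies) every finitely generated ideal extends to an invertible ideal of
    [D_M].

    (i) => (ii): by finite character [D_M] is the intersection of the
    valuation rings of the Krull family that lie over [M]; invertibility and
    integrality make them all positive on [M], hence finite in number, and a
    nonzero prime inside [M] contains a power of each element of [M].  For an
    ideal [I] with [E = (I : I)], [I(E : I)] is locally idempotent, so it
    contains a unit of each of these discrete valuation rings and equals [E].

    (ii) => (i): stability applied to the ideals [xR_M \cap R] isolates [M]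
    among the star-maximal ideals containing [x], so by finite type these are
    finitely many.  Locally, every fractional ideal between [R_M] and [D_M] is
    a ring, so [D_M] is quadratic over [R_M]: squares of elements of a prime of
    [D_M] are multiples of elements of [M].  Together with stability of [M]
    this makes the localization a discrete valuation ring, and a residue count
    leaves at most three of them over each [M]. *)

(** No chain condition is available, so integrality enters only through its definition: elements of
    the closure stabilize a common finitely generated ideal, hence act on its generators by matrices
    over the localized base ring. These matrices feed one determinant lemma in which [H] may lack
    [1]. With [H] a trace ideal, a prime or an ideal closed under products, the same computation
    yields invertibility, powers lying in a prime, and lying over. In place of an approximation
    theorem for the Krull family stands the identity [a * c + b * d = 1] with all four cross
    products in the localized closure. The same identity makes the localizations of the closure
    valuation rings in the converse direction. Dimension one is used in one form: for [y] in [M] and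
    nonzero [t], some power of [y] is divisible by [t] in the localized ring. *)

Section Rings.
Variable K : fieldType.
Implicit Types A B I J H : set K.

Definition add_closed H : Prop := H 0 /\ forall x y, H x -> H y -> H (x - y).

Lemma add_closedN H x : add_closed H -> H x -> H (- x).
Proof. by move=> [H0 HB] Hx; rewrite -sub0r; apply: HB. Qed.

Lemma add_closedD H x y : add_closed H -> H x -> H y -> H (x + y).
Proof.
by move=> hH Hx Hy; rewrite -[y]opprK; apply: hH.2 => //; apply: add_closedN.
Qed.

Lemma add_closed_sum H (T : Type) (r : seq T) (P : pred T) (F : T -> K) :
  add_closed H -> (forall i, P i -> H (F i)) -> H (\sum_(i <- r | P i) F i).
Proof.
by move=> hH hF; apply: (big_ind H) => //;
  [exact: hH.1 | move=> x y; exact: add_closedD].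
Qed.

Lemma subring_add A : subring A -> add_closed A.
Proof. by case=> A1 AB _; split=> //; rewrite -(subrr 1); apply: AB. Qed.

Lemma subringX A x n : subring A -> A x -> A (x ^+ n).
Proof.
move=> [A1 _ AM] Ax; elim: n => [|n IH]; first by rewrite expr0.
by rewrite exprS; apply: AM.
Qed.

Lemma submodule_add A I : subring A -> submodule A I -> add_closed I.
Proof.
move=> hA [I0 ID IZ]; split=> // x y Ix Iy; apply: ID => //.
rewrite -mulN1r; apply: IZ => //; apply: add_closedN; first exact: subring_add.
by case: hA.
Qed.

Lemma ring_submodule A : subring A -> submodule A A.
Proof.
move=> hA; split; first exact: (subring_add hA).1; last by case: hA.
by move=> x y; apply: add_closedD; exact: subring_add.
Qed.

(** [H] is an ideal of its multiplier ring [B]; modulo [H] the matrix is congruent to the scalar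
    matrix [y], and the Leibniz expansion respects congruence. *)
Lemma det_congr H n (y : K) (N : 'I_n -> 'I_n -> K) :
  add_closed H -> (forall a b, H a -> H b -> H (a * b)) ->
  (forall h, H h -> H (y * h)) -> (forall i j, H (N i j)) ->
  H (y ^+ n - \det (\matrix_(i, j) (y *+ (i == j) - N i j))).
Proof.
move=> hH HM Hy HN.
pose B x := forall h, H h -> H (x * h).
pose R x x' := [/\ B x, B x' & H (x - x')].
have R1 x : B x -> R x x by split=> //; rewrite subrr; exact: hH.1.
have BD a b : B a -> B b -> B (a + b).
  by move=> Ba Bb h Hh; rewrite mulrDl; apply: add_closedD; [|apply: Ba|apply: Bb].
have BN a : B a -> B (- a).
  by move=> Ba h Hh; rewrite mulNr; apply: add_closedN => //; apply: Ba.
have B0 : B 0 by move=> h _; rewrite mul0r; exact: hH.1.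
have B1 : B 1 by move=> h; rewrite mul1r.
have RD : forall x1 x2 y1 y2, R x1 x2 -> R y1 y2 -> R (x1 + y1) (x2 + y2).
  move=> a a' b b' [Ba Ba' Ha] [Bb Bb' Hb]; split; try exact: BD.
  by rewrite opprD addrACA; apply: add_closedD.
have RM : forall x1 x2 y1 y2, R x1 x2 -> R y1 y2 -> R (x1 * y1) (x2 * y2).
  move=> a a' b b' [Ba Ba' Ha] [Bb Bb' Hb]; split.
  - by move=> h Hh; rewrite -mulrA; apply/Ba/Bb.
  - by move=> h Hh; rewrite -mulrA; apply/Ba'/Bb'.
  have -> : a * b - a' * b' = a * (b - b') + b' * (a - a') by ring.
  by apply: add_closedD => //; [apply: Ba|apply: Bb'].
suff [] : R (\det (y%:M : 'M_n)) (\det (\matrix_(i, j) (y *+ (i == j) - N i j))).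
  by rewrite det_scalar.
rewrite /determinant; apply: (big_ind2 R) => [||s _]; [exact: R1|exact: RD|].
apply: (RM).
  by apply: R1; case: (odd_perm s); rewrite ?expr0 ?expr1 //; exact: BN.
apply: (big_ind2 R) => [||i _]; [exact: R1|exact: RM|].
rewrite !mxE.
have By : B (y *+ (i == s i)) by case: (i == s i).
split=> //.
  apply: BD => //; apply: BN => h Hh; exact: HM.
by rewrite opprB addrC subrK.
Qed.

(** The vector [t] makes the determinant of [det_congr] vanish. Most uses take [y] equal to [1] and
    conclude that [1] lies in [H]. *)
Lemma det_trick H n (y : K) (N : 'I_n -> 'I_n -> K) (t : 'I_n -> K) :
  add_closed H -> (forall a b, H a -> H b -> H (a * b)) ->
  (forall h, H h -> H (y * h)) -> (forall i j, H (N i j)) ->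
  (exists i, t i != 0) -> (forall i, y * t i = \sum_j N i j * t j) ->
  H (y ^+ n).
Proof.
move=> hH HM Hy HN [i0 ti0] e.
have := det_congr hH HM Hy HN.
set D := \matrix_(i, j) _.
suff /eqP -> : \det D == 0 by rewrite subr0.
rewrite -det_tr; apply/det0P; exists (\row_i t i).
  by apply: contra ti0 => /eqP/rowP/(_ i0); rewrite !mxE => ->.
apply/rowP => i; rewrite !mxE.
under eq_bigr => j _ do rewrite !mxE mulrBr.
rewrite sumrB (bigD1 i) //= eqxx mulr1n big1 => [|j /negPf nji].
  by rewrite addr0 mulrC e; under eq_bigr => j _ do rewrite mulrC; rewrite subrr.
by rewrite eq_sym nji mulr0.
Qed.

End Rings.

(** * Submodules and fractional ideals inside [K] *)

Section Ideals.
Variables (K : fieldType) (A : set K).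
Hypothesis hA : subring A.
Implicit Types I J H M P : set K.

Let A1 : A 1. Proof. by case: hA. Qed.
Let AM x y : A x -> A y -> A (x * y). Proof. by case: hA => _ _; apply. Qed.
Let A0 : A 0. Proof. exact: (subring_add hA).1. Qed.

Lemma ideal_mul_gen I J x y : I x -> J y -> ideal_mul I J (x * y).
Proof.
move=> Ix Jy; exists 1%N, (fun=> x), (fun=> y); split=> //.
by rewrite big_ord1.
Qed.

Lemma ideal_mul_sub I J H : add_closed H ->
  (forall x y, I x -> J y -> H (x * y)) -> ideal_mul I J `<=` H.
Proof.
by move=> hH hm _ [n [a [b [Ia Jb ->]]]]; apply: add_closed_sum => // i _; apply: hm.
Qed.

Lemma ideal_mul_submodule I J : submodule A I -> submodule A (ideal_mul I J).
Proof.
move=> [I0 ID IZ]; split.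
- by exists 0%N, (fun=> 0), (fun=> 0); split=> [[]|[]|] //; rewrite big_ord0.
- move=> _ _ [n [a [b [Ia Jb ->]]]] [m [c [d [Ic Jd ->]]]].
  exists (n + m)%N, (fun i => match fintype.split i with inl j => a j | inr j => c j end),
   (fun i => match fintype.split i with inl j => b j | inr j => d j end); split.
  + by move=> i; case: fintype.split.
  + by move=> i; case: fintype.split.
  rewrite big_split_ord /=; congr (_ + _); apply: eq_bigr => i _.
  + by rewrite (unsplitK (inl _ i)).
  + by rewrite (unsplitK (inr _ i)).
- move=> c _ Ac [n [a [b [Ia Jb ->]]]]; exists n, (fun i => c * a i), b.
  split=> // [i|]; first exact: IZ.
  by rewrite mulr_sumr; apply: eq_bigr => i _; rewrite mulrA.
Qed.

Lemma ideal_mul_ideal I J : ideal A I -> ideal A J -> ideal A (ideal_mul I J).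
Proof.
move=> [sI [x Ix x0] [d [Ad d0 dI]]] [sJ [y Jy y0] [e [Ae e0 eJ]]]; split.
- exact: ideal_mul_submodule.
- by exists (x * y); [exact: ideal_mul_gen | rewrite mulf_neq0].
exists (d * e); split; [exact: AM | by rewrite mulf_neq0|].
apply: (@ideal_mul_sub I J [set z | A (d * e * z)]).
  split=> [/=|a b /= ha hb]; first by rewrite mulr0.
  by rewrite mulrBr; apply: (subring_add hA).2.
move=> a b Ia Jb /=; rewrite mulrACA; apply: AM; [exact: dI|exact: eJ].
Qed.

Lemma colon_submodule I J : submodule A J -> submodule A (colon J I).
Proof.
move=> [J0 JD JZ]; split=> [y _|x y hx hy z Iz|a x Aa hx z Iz].
- by rewrite mul0r.
- by rewrite mulrDl; apply: JD; [apply: hx|apply: hy].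
- by rewrite -mulrA; apply: JZ => //; apply: hx.
Qed.

Hypothesis hK : forall x, exists a b, [/\ A a, A b, b != 0 & x = a / b].

Lemma denominator x : exists b, [/\ A b, b != 0 & A (b * x)].
Proof.
have [a [b [Aa Ab b0 ->]]] := hK x; exists b; split=> //.
by rewrite mulrC divfK.
Qed.

Lemma denominators (n : nat) (x : 'I_n -> K) :
  exists b, [/\ A b, b != 0 & forall i, A (b * x i)].
Proof.
have /choice[b hb] := fun i => denominator (x i).
exists (\prod_i b i); split.
- by apply: (big_ind A) => // i _; case: (hb i).
- by apply/prodf_neq0 => i _; case: (hb i).
move=> i; rewrite (bigD1 i) //= mulrAC; apply: AM; first by case: (hb i).
by apply: (big_ind A) => // j _; case: (hb j).
Qed.

Lemma colon_ideal I J : ideal A I -> ideal A J -> ideal A (colon J I).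
Proof.
move=> [sI [x Ix x0] [d [Ad d0 dI]]] [sJ [y Jy y0] [e [Ae e0 eJ]]]; split.
- exact: colon_submodule.
- exists (d * y); last by rewrite mulf_neq0.
  by move=> z Iz; rewrite mulrAC; case: sJ => _ _; apply=> //; apply: dI.
have [b [Ab b0 Abx]] := denominator x.
exists (e * (b * x)); split; [exact: AM | by rewrite !mulf_neq0|].
move=> z hz; have -> : e * (b * x) * z = b * (e * (z * x)) by ring.
by apply: AM => //; apply/eJ/hz.
Qed.

Lemma ring_ideal : ideal A A.
Proof.
split; first exact: ring_submodule.
- by exists 1 => //; exact: oner_neq0.
- by exists 1; split=> //; [exact: oner_neq0|move=> x Ax; rewrite mul1r].
Qed.

(** Any finite index type is allowed because products of two generating families are indexed by
    pairs; [span_ord] returns to ordinals. *)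
Definition span (T : finType) (g : T -> K) : set K :=
  [set x | exists2 c : T -> K, (forall i, A (c i)) & x = \sum_i c i * g i].

Lemma span_gen (T : finType) (g : T -> K) i : span g (g i).
Proof.
exists (fun j => (j == i)%:R) => [j|]; first by case: (j == i).
rewrite (bigD1 i) //= eqxx mul1r big1 ?addr0 // => j /negPf ->.
by rewrite mul0r.
Qed.

Lemma span_submodule (T : finType) (g : T -> K) : submodule A (span g).
Proof.
split.
- by exists (fun=> 0) => //; rewrite big1 // => i _; rewrite mul0r.
- move=> _ _ [c Ac ->] [d Ad ->]; exists (fun i => c i + d i) => [i|].
    by apply: add_closedD; first exact: subring_add.
  by rewrite -big_split; apply: eq_bigr => i _; rewrite mulrDl.
- move=> a _ Aa [c Ac ->]; exists (fun i => a * c i) => [i|]; first exact: AM.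
  by rewrite mulr_sumr; apply: eq_bigr => i _; rewrite mulrA.
Qed.

Lemma submodule_sum I (T : finType) (c g : T -> K) : submodule A I ->
  (forall i, A (c i)) -> (forall i, I (g i)) -> I (\sum_i c i * g i).
Proof.
move=> sI Ac Ig; apply: add_closed_sum; first exact: submodule_add hA sI.
by move=> i _; case: sI => _ _; apply.
Qed.

Lemma span_sub I (T : finType) (g : T -> K) : submodule A I ->
  (forall i, I (g i)) -> span g `<=` I.
Proof. by move=> sI Ig _ [c Ac ->]; apply: submodule_sum. Qed.

Lemma span_ord (T : finType) (g : T -> K) :
  span (fun i : 'I_#|T| => g (enum_val i)) = span g.
Proof.
rewrite predeqE => x; split=> -[c Ac ->].
  exists (fun i => c (enum_rank i)) => // .
  rewrite (reindex (@enum_val T T)) /=; last by exists enum_rank => i _; rewrite ?enum_valK ?enum_rankK.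
  by apply: eq_bigr => i _; rewrite enum_valK.
exists (fun i => c (enum_val i)) => //.
by rewrite (reindex (@enum_val T T)) //=; exists enum_rank => i _; rewrite ?enum_valK ?enum_rankK.
Qed.

Lemma span_ideal (n : nat) (g : 'I_n -> K) : (exists i, g i != 0) -> ideal A (span g).
Proof.
move=> [i gi0]; split; first exact: span_submodule.
- by exists (g i) => //; exact: span_gen.
have [b [Ab b0 Abg]] := denominators g.
exists b; split=> //; apply: (@span_sub [set z | A (b * z)]) => //.
split=> [/=|x y /= ? ?|a x /= Aa ?]; first by rewrite mulr0.
- by rewrite mulrDr; apply: add_closedD; first exact: subring_add.
- by rewrite mulrCA; apply: AM.
Qed.

Lemma span_fg_ideal (n : nat) (g : 'I_n -> K) :
  (exists i, g i != 0) -> fg_ideal A (span g).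
Proof. by move=> hg; split; [exact: span_ideal|exists n, g]. Qed.

Lemma fg_idealP J : fg_ideal A J ->
  exists n (g : 'I_n -> K), (exists i, g i != 0) /\ J = span g.
Proof.
move=> [[_ [x Jx x0] _] [n [g e]]]; exists n, g; split=> //.
apply: contrapT => /forallNP hg; move: Jx x0; rewrite e => -[c _ ->].
rewrite big1 ?eqxx // => i _.
by have /negP := hg i; rewrite negbK => /eqP ->; rewrite mulr0.
Qed.

End Ideals.

(** * Localization at a prime *)

Section Localization.
Variables (K : fieldType) (A M : set K).
Hypotheses (hA : subring A) (hM : spec_prime A M).
Implicit Types I J H : set K.

(** Clearing one denominator replaces the sums of products in [extend], with which it agrees on
    submodules by [extendE]. *)
Definition loc (I : set K) : set K := [set x | exists s, [/\ A s, ~ M s & I (s * x)]].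

Let AM x y : A x -> A y -> A (x * y). Proof. by case: hA => _ _; apply. Qed.

Lemma prime1 : ~ M 1.
Proof.
case: hM => -[_ _ MZ] MA MnA _ M1; apply: MnA; rewrite predeqE => x; split; first exact: MA.
by move=> Ax; rewrite -[x]mulr1; apply: MZ.
Qed.

Lemma primeM x y : A x -> A y -> ~ M x -> ~ M y -> ~ M (x * y).
Proof. by case: hM => _ _ _ h Ax Ay nx ny /h []. Qed.

Lemma prime_prod (T : finType) (s : T -> K) :
  (forall i, A (s i) /\ ~ M (s i)) -> A (\prod_i s i) /\ ~ M (\prod_i s i).
Proof.
move=> hs; apply: (big_ind (fun x => A x /\ ~ M x)) => //.
  by split; [case: hA|exact: prime1].
by move=> x y [? ?] [? ?]; split; [exact: AM|exact: primeM].
Qed.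

Lemma primeX x n : A x -> ~ M x -> ~ M (x ^+ n).
Proof.
move=> Ax nx; elim: n => [|n IH]; first by rewrite expr0; exact: prime1.
by rewrite exprS; apply: primeM => //; apply: subringX.
Qed.

Lemma notin_prime_neq0 s : ~ M s -> s != 0.
Proof. by case: hM => -[M0 _ _] _ _ _ ns; apply/eqP => e; apply: ns; rewrite e. Qed.

Lemma sub_loc I : I `<=` loc I.
Proof. by move=> x Ix; exists 1; split; [case: hA|exact: prime1|rewrite mul1r]. Qed.

Lemma loc_mono I J : I `<=` J -> loc I `<=` loc J.
Proof. by move=> IJ x [s [As ns h]]; exists s; split=> //; apply: IJ. Qed.

Lemma loc_unit I s x : A s -> ~ M s -> loc I (s * x) -> loc I x.
Proof.
move=> As ns [r [Ar nr h]]; exists (r * s); split; [exact: AM|exact: primeM|].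
by rewrite -mulrA.
Qed.

Lemma loc_submodule I : submodule A I -> submodule A (loc I).
Proof.
move=> [I0 ID IZ]; split; first exact: sub_loc.
- move=> x y [s [As ns hs]] [r [Ar nr hr]]; exists (s * r).
  split; [exact: AM|exact: primeM|]; rewrite mulrDr; apply: ID.
    by rewrite mulrAC mulrC; apply: IZ.
  by rewrite -mulrA; apply: IZ.
- by move=> a x Aa [s [As ns hs]]; exists s; split=> //; rewrite mulrCA; apply: IZ.
Qed.

Lemma loc_add I : submodule A I -> add_closed (loc I).
Proof. by move=> sI; apply: submodule_add hA _; apply: loc_submodule. Qed.

Lemma locM I J L x y : (forall a b, I a -> J b -> L (a * b)) ->
  loc I x -> loc J y -> loc L (x * y).
Proof.
move=> h [s [As ns hs]] [r [Ar nr hr]]; exists (s * r).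
by split; [exact: AM|exact: primeM|rewrite mulrACA; apply: h].
Qed.

Lemma locZ I a x : submodule A I -> loc A a -> loc I x -> loc I (a * x).
Proof. by move=> [_ _ IZ]; apply: locM. Qed.

Lemma loc_inv s : A s -> ~ M s -> loc A s^-1.
Proof.
move=> As ns; exists s; split=> //.
by rewrite divff; [case: hA|exact: notin_prime_neq0].
Qed.

Lemma loc_subring B : subring B -> A `<=` B -> subring (loc B).
Proof.
move=> hB AB.
have sB : submodule A B.
  by case: (ring_submodule hB) => ? ? h; split=> // a x /AB; apply: h.
split.
- by apply: sub_loc; case: hB.
- exact: (loc_add sB).2.
- by move=> x y; apply: locM; case: hB.
Qed.

Lemma loc_common I (T : finType) (x : T -> K) : submodule A I ->
  (forall i, loc I (x i)) -> exists s, [/\ A s, ~ M s & forall i, I (s * x i)].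
Proof.
move=> [_ _ IZ] /choice[s hs]; exists (\prod_i s i).
have hs' i : A (s i) /\ ~ M (s i) by case: (hs i).
have [Ap np] := prime_prod hs'; split=> // i.
rewrite (bigD1 i) //= mulrAC mulrC; apply: IZ; last by case: (hs i).
apply: (big_ind A) => [||j _]; [by case: hA|exact: AM|exact: (hs' j).1].
Qed.

Lemma loc_prime Q x : spec_prime A Q -> Q `<=` M -> A x -> loc Q x -> Q x.
Proof.
move=> [_ QA _ Qp] QM Ax [s [As ns h]]; case: (Qp _ _ As Ax h) => // /QM //.
Qed.

Lemma extendE I : submodule A I -> extend A I M = loc I.
Proof.
move=> sI; rewrite predeqE => x; split.
  apply: ideal_mul_sub; first exact: loc_add.
  move=> a _ Ia [c [s [Ac As ns ->]]]; exists s; split=> //.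
  have s0 := notin_prime_neq0 ns.
  have -> : s * (a * (c / s)) = c * a by field.
  by case: sI => _ _; apply.
move=> [s [As ns h]]; have s0 := notin_prime_neq0 ns.
have -> : x = (s * x) * (1 / s) by field.
by apply: ideal_mul_gen => //; exists 1, s; split=> //; case: hA.
Qed.

End Localization.

(** * Star-maximal ideals and the star-integral closure *)

Record spectral_setting (K : fieldType) (A : set K) (star : set K -> set K) : Prop :=
  SpectralSetting {
    setting_ring : subring A;
    setting_frac : forall x, exists a b, [/\ A a, A b, b != 0 & x = a / b];
    setting_star : star_operation A star;
    setting_tilde : star_eq A star (star_tilde A star);
    setting_finite : finite_type A star }.

Section Star.
Variables (K : fieldType) (A : set K) (star : set K -> set K).
Hypothesis h : spectral_setting A star.
Implicit Types I J H M : set K.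

Let hA : subring A := setting_ring h.
Let hK := setting_frac h.
Let hS := setting_star h.
Let A1 : A 1. Proof. by case: hA. Qed.
Let AM x y : A x -> A y -> A (x * y). Proof. by case: hA => _ _; apply. Qed.
Let A0 : A 0. Proof. exact: (subring_add hA).1. Qed.

Lemma scale_ideal y J : y != 0 -> ideal A J -> ideal A [set y * x | x in J].
Proof.
move=> y0 [[J0 JD JZ] [x Jx x0] [d [Ad d0 dJ]]]; split.
- split; first by exists 0; rewrite ?mulr0.
  + by move=> _ _ [a Ja <-] [b Jb <-]; exists (a + b); rewrite ?mulrDr //; apply: JD.
  + by move=> c _ Ac [a Ja <-]; exists (c * a); rewrite 1?mulrCA //; apply: JZ.
- by exists (y * x); [exists x|rewrite mulf_neq0].
have [b [Ab b0 Aby]] := denominator hK y.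
exists (b * d); split; [exact: AM|exact: mulf_neq0|].
by move=> _ [a Ja <-]; rewrite mulrACA; apply: AM => //; apply: dJ.
Qed.

Lemma star_max_ideal M : star_max A star M -> ideal A M.
Proof. by case=> [[[]]]. Qed.

(** If [x] is outside [M], maximality forces [1] into the closure of [M + A x]; multiplying by [y]
    then puts [y] in [star M], which is [M]. *)
Lemma star_max_prime M : star_max A star M -> spec_prime A M.
Proof.
move=> mM; have iM := star_max_ideal mM; have [sM _ _] := iM.
have [[[_ Me] MA MnA] Mmax] := mM; split=> // x y Ax Ay Mxy.
case: (pselect (M x)) => [|nx]; [by left|right].
have [M0 MD MZ] := sM.
pose J := [set z | exists2 m, M m & exists2 a, A a & z = m + a * x].
have sJ : submodule A J.
  split; first by exists 0 => //; exists 0; rewrite // mul0r addr0.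
  - move=> _ _ [m Mm [a Aa ->]] [n Mn' [b Ab ->]].
    exists (m + n); first exact: MD.
    exists (a + b); last by ring.
    by apply: add_closedD => //; apply: subring_add.
  - move=> c _ Ac [m Mm [a Aa ->]]; exists (c * m); first exact: MZ.
    by exists (c * a); [exact: AM|ring].
have MJ : M `<=` J by move=> m Mm; exists m => //; exists 0; rewrite // mul0r addr0.
have JA : J `<=` A.
  move=> _ [m Mm [a Aa ->]]; apply: add_closedD; [exact: subring_add|exact: MA|exact: AM].
have iJ : ideal A J.
  split=> //; first by case: iM => _ [m Mm m0] _; exists m => //; apply: MJ.
  by exists 1; split=> //; [exact: oner_neq0|move=> z /JA; rewrite mul1r].
have isJ := star_ideal_closed hS iJ.
have sJ1 : star J 1.
  apply: contrapT => n1; apply: nx.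
  have pJ : proper_integral_star_ideal A star (star J).
    split; [by split=> //; apply: star_idempotent hS _ iJ| |by move=> e; rewrite e in n1].
    by rewrite -[X in _ `<=` X](star_ring hS); apply: star_monotone hS _ _ iJ (ring_ideal hA) JA.
  rewrite -(Mmax _ pJ); last first.
    by apply: subset_trans MJ _; apply: star_extensive hS _ iJ.
  apply: (star_extensive hS iJ); exists 0 => //; exists 1; rewrite // mul1r add0r //.
case: (eqVneq y 0) => [->//|y0].
have ysJ : star [set y * x | x in J] y.
  by rewrite (star_scale hS y0 iJ); exists 1; rewrite ?mulr1.
rewrite -Me; apply: (star_monotone hS (scale_ideal y0 iJ) iM _ ysJ).
move=> _ [_ [m Mm [a Aa ->]] <-]; rewrite mulrDr; apply: MD; first exact: MZ.
by rewrite mulrCA; apply: MZ => //; rewrite mulrC.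
Qed.

Lemma starE I x : ideal A I ->
  star I x <-> forall M, star_max A star M -> loc A M I x.
Proof.
move=> iI; rewrite (setting_tilde h iI); have sI : submodule A I by case: iI.
split=> [hx M mM|hx M mM].
  by rewrite -(extendE hA (star_max_prime mM) sI); apply: hx.
by rewrite (extendE hA (star_max_prime mM) sI); apply: hx.
Qed.

Lemma star_submodule I : ideal A I -> submodule A (star I).
Proof. by move=> /(star_ideal_closed hS)[]. Qed.

Lemma star_colon I L x : ideal A I -> ideal A L ->
  (forall y, I y -> star L (x * y)) -> forall y, star I y -> star L (x * y).
Proof.
move=> iI iL hx y /(starE _ iI) hy; apply/(starE _ iL) => M mM.
have [s [As ns /hx]] := hy M mM.
rewrite mulrCA => hs; apply: (loc_unit hA (star_max_prime mM) As ns).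
by move/(starE _ iL): hs; apply.
Qed.

(** Quasi-compactness of the star-maximal spectrum: [1] is in [I] locally, hence in [star I], hence
    by finite type in the closure of a finitely generated [J] inside [I]. *)
Lemma star_compact I : ideal A I -> I `<=` A ->
  (forall M, star_max A star M -> exists2 s, I s & ~ M s) ->
  exists n (g : 'I_n -> K), (forall i, I (g i)) /\
    forall M, star_max A star M -> exists i, ~ M (g i).
Proof.
move=> iI IA hI.
have : star I 1.
  apply/(starE _ iI) => M mM; have [s Is ns] := hI M mM.
  by exists s; rewrite mulr1; split=> //; apply: IA.
rewrite (setting_finite h iI) => -[J [fJ JI] J1].
have [n [g [hg eJ]]] := fg_idealP fJ.
have Ig i : I (g i) by apply: JI; rewrite eJ; apply: span_gen.
exists n, g; split=> // M mM.
have [sM _ _ _] := star_max_prime mM.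
apply: contrapT => /forallNP hn.
have [s [As ns]] : loc A M J 1 by move/(starE _ (proj1 fJ)): J1; apply.
rewrite mulr1 eJ => Js; apply: ns; apply: (span_sub hA sM _ Js) => i.
exact: contrapT (hn i).
Qed.

Definition intclosure := star_integral_closure A star.
Local Notation D := intclosure.

Lemma intclosure_intro n (t : 'I_n -> K) x : (exists i, t i != 0) ->
  (forall M, star_max A star M -> forall j, loc A M (span A t) (x * t j)) -> D x.
Proof.
move=> ht hx; have iJ := span_ideal hA hK ht.
exists (span A t); first exact: span_fg_ideal.
apply: (star_colon iJ iJ) => _ [c Ac ->].
rewrite mulr_sumr.
under eq_bigr => i _ do rewrite mulrCA.
apply: (submodule_sum hA (star_submodule iJ) Ac) => i.
by apply/(starE _ iJ) => M mM; apply: hx.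
Qed.

(** Stabilizers of two finitely generated ideals both stabilize the product ideal, generated by the
    [t i * u j]. *)
Lemma intclosure_common (s : seq K) : (forall x, x \in s -> D x) ->
  exists n (t : 'I_n -> K), (exists i, t i != 0) /\
    forall x, x \in s -> forall M, star_max A star M ->
      forall j, loc A M (span A t) (x * t j).
Proof.
elim: s => [|x s IH] hs.
  exists 1%N, (fun=> 1); split=> //; exists ord0; exact: oner_neq0.
have [n [t [[i0 ti0] ht]]] : exists n (t : 'I_n -> K), (exists i, t i != 0) /\
    forall x, x \in s -> forall M, star_max A star M ->
      forall j, loc A M (span A t) (x * t j).
  by apply: IH => y ys; apply: hs; rewrite inE ys orbT.
have [J fJ hx] : D x by apply: hs; rewrite inE eqxx.
have [m [u [[j0 uj0] eJ]]] := fg_idealP fJ.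
pose g (p : 'I_n * 'I_m) := t p.1 * u p.2.
exists #|{: 'I_n * 'I_m}|, (fun i => g (enum_val i)); split.
  by exists (enum_rank (i0, j0)); rewrite enum_rankK mulf_neq0.
move=> y ys M mM k; rewrite span_ord; move: (enum_val k) => [i j]; rewrite /g /=.
have pM := star_max_prime mM.
move: ys; rewrite inE => /orP[/eqP ->{y}|ys].
  have : loc A M J (x * u j).
    suff /(starE _ (proj1 fJ)) : star J (x * u j) by apply.
    apply: hx; apply: (star_extensive hS (proj1 fJ)).
    by rewrite eJ; apply: span_gen.
  rewrite eJ mulrCA; apply: (locM hA pM _ (sub_loc hA pM (erefl : [set t i] (t i)))).
  move=> _ _ -> [c Ac ->]; rewrite mulr_sumr.
  under eq_bigr => l _ do rewrite mulrCA.
  apply: (submodule_sum hA (span_submodule hA g) Ac) => l.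
  exact: (span_gen hA g (i, l)).
have := ht y ys M mM i.
rewrite mulrA => hl; apply: (locM hA pM _ hl (sub_loc hA pM (erefl : [set u j] (u j)))).
move=> _ _ [c Ac ->] ->; rewrite mulr_suml.
under eq_bigr => l _ do rewrite -mulrA.
apply: (submodule_sum hA (span_submodule hA g) Ac) => l.
exact: (span_gen hA g (l, j)).
Qed.

Lemma sub_intclosure : A `<=` D.
Proof.
move=> x Ax; apply: (@intclosure_intro 1 (fun=> 1)).
  by exists ord0; exact: oner_neq0.
move=> M mM j; apply: (sub_loc hA (star_max_prime mM)).
by case: (span_submodule hA (fun=> 1 : K) : submodule A (span A (fun _ : 'I_1 => 1))) => _ _ hZ;
  apply: hZ => //; apply: span_gen.
Qed.

Lemma intclosure_subring : subring D.
Proof.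
have aux x y : D x -> D y -> exists n (t : 'I_n -> K), (exists i, t i != 0) /\
   forall M, star_max A star M -> forall j,
     loc A M (span A t) (x * t j) /\ loc A M (span A t) (y * t j).
  move=> Dx Dy; have [z|n [t [ht hc]]] := @intclosure_common [:: x; y].
    by rewrite !inE => /orP[]/eqP ->.
  by exists n, t; split=> // M mM j; split; apply: hc; rewrite ?inE ?eqxx ?orbT.
split=> [|x y Dx Dy|x y Dx Dy]; first exact: sub_intclosure.
- have [n [t [ht hc]]] := aux x y Dx Dy.
  apply: (intclosure_intro ht) => M mM j; have [hx hy] := hc M mM j.
  rewrite mulrBl; apply: (loc_add hA (star_max_prime mM) (span_submodule hA t)).2 => //.
have [n [t [ht hc]]] := aux x y Dx Dy.
apply: (intclosure_intro ht) => M mM j; have [_ [s [As ns [c Ac e]]]] := hc M mM j.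
have pM := star_max_prime mM.
apply: (loc_unit hA pM As ns).
have -> : s * (x * y * t j) = x * (s * (y * t j)) by ring.
rewrite e mulr_sumr; under eq_bigr => l _ do rewrite mulrCA.
apply: (submodule_sum hA (loc_submodule hA pM (span_submodule hA t)) Ac) => l.
by have [] := hc M mM l.
Qed.

Lemma intclosure_submodule : submodule A D.
Proof.
have [D0 DD DZ] := ring_submodule intclosure_subring.
by split=> // a x /sub_intclosure; apply: DZ.
Qed.

(** The conductor [C] of [x] into [D] escapes every star-maximal ideal, so finitely many of its
    elements do so jointly. Their multiples of [x] stabilize one common finitely generated ideal,
    and locally so does [x]. *)
Lemma intclosure_loc x : (forall M, star_max A star M -> loc A M D x) -> D x.
Proof.
move=> hx; pose C := [set s | A s /\ D (s * x)].
have DA := intclosure_submodule.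
have iC : ideal A C.
  split.
  - split; first by split=> //; rewrite mul0r; case: DA.
    + move=> a b [Aa Da] [Ab Db]; split.
        by apply: add_closedD => //; exact: subring_add.
      by rewrite mulrDl; case: DA => _ hD _; apply: hD.
    + by move=> a b Aa [Ab Db]; split; [exact: AM|rewrite -mulrA; case: DA => _ _; apply].
  - have [b [Ab b0 Abx]] := denominator hK x.
    by exists b => //; split=> //; apply: sub_intclosure.
  - exists 1; split=> //; [exact: oner_neq0|by move=> y []; rewrite mul1r].
have [|M mM|n [g [Cg hg]]] := star_compact iC; first by move=> y [].
  by have [s [As ns Ds]] := hx M mM; exists s.
have [z /mapP[i _ ->]|m [t [ht hc]]] := @intclosure_common [seq g i * x | i <- enum 'I_n].
  by case: (Cg i).
apply: (intclosure_intro ht) => M mM j; have [i ni] := hg M mM.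
have [Agi _] := Cg i.
apply: (loc_unit hA (star_max_prime mM) Agi ni); rewrite mulrA.
by apply: hc => //; apply: map_f; rewrite mem_enum.
Qed.

Lemma loc_span M (T : finType) (t : T -> K) z : star_max A star M ->
  loc A M (span A t) z ->
  exists2 N : T -> K, (forall j, loc A M A (N j)) & z = \sum_j N j * t j.
Proof.
move=> mM [s [As ns [c Ac e]]]; have pM := star_max_prime mM.
have s0 := notin_prime_neq0 pM ns.
exists (fun j => c j / s) => [j|].
  exists s; split=> //.
  by rewrite mulrC divfK.
apply: (mulfI s0); rewrite e mulr_sumr; apply: eq_bigr => i _.
by rewrite mulrA [s * _]mulrC divfK.
Qed.

Lemma loc_intclosure_common M n (x : 'I_n -> K) : star_max A star M ->
  (forall i, loc A M D (x i)) ->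
  exists m (t : 'I_m -> K), (exists i, t i != 0) /\
    forall i, exists2 N : 'I_m -> 'I_m -> K, (forall j k, loc A M A (N j k))
      & forall j, x i * t j = \sum_k N j k * t k.
Proof.
move=> mM hx; have pM := star_max_prime mM.
have [s [As ns hs]] := loc_common hA pM intclosure_submodule hx.
have [z /mapP[i _ ->]//|m [t [ht hc]]] := @intclosure_common [seq s * x i | i <- enum 'I_n].
exists m, t; split=> // i.
have hl j : loc A M (span A t) (x i * t j).
  apply: (loc_unit hA pM As ns); rewrite mulrA; apply: hc => //.
  by apply: map_f; rewrite mem_enum.
have /choice[N hN] : forall j, exists N : 'I_m -> K,
    (forall k, loc A M A (N k)) /\ x i * t j = \sum_k N k * t k.
  by move=> j; have [N h1 h2] := loc_span mM (hl j); exists N.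
by exists N; [move=> j; case: (hN j)|move=> j; case: (hN j)].
Qed.

Lemma lying_over M H n (b c : 'I_n -> K) : star_max A star M ->
  submodule A H -> (forall x y, H x -> H y -> H (x * y)) ->
  (forall i, loc A M H (b i)) -> (forall i, loc A M D (c i)) ->
  \sum_i b i * c i = 1 -> loc A M H 1.
Proof.
move=> mM sH HM hb hc e; have pM := star_max_prime mM.
have [m [t [ht hN]]] := loc_intclosure_common mM hc.
have /choice[N {}hN] : forall i, exists N : 'I_m -> 'I_m -> K,
    (forall j k, loc A M A (N j k)) /\ forall j, c i * t j = \sum_k N j k * t k.
  by move=> i; have [N h1 h2] := hN i; exists N.
rewrite -(expr1n _ m).
(* Replacing each [c i] by its matrix in [\sum_i b i * c i] gives a matrix over the localization of
   [H] that fixes [t]. *)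
apply: (@det_trick _ _ _ _ (fun j k => \sum_i b i * N i j k) t (loc_add hA pM sH)) => //.
- by move=> x y; apply: (locM hA pM).
- by move=> x; rewrite mul1r.
- move=> j k; apply: add_closed_sum; first exact: loc_add.
  by move=> i _; rewrite mulrC; apply: (locZ hA pM) => //; case: (hN i).
move=> j; rewrite -e mulr_suml; under [RHS]eq_bigr => k _ do rewrite mulr_suml.
rewrite exchange_big; apply: eq_bigr => i _ /=.
rewrite -mulrA; have [_ ->] := hN i; rewrite mulr_sumr.
by apply: eq_bigr => k _; rewrite mulrA.
Qed.

End Star.

(** * Primes avoiding a multiplicative set *)

Lemma prime_avoiding (K : fieldType) (B S I : set K) : subring B ->
  submodule B I -> I `<=` B -> S 1 -> (forall x y, S x -> S y -> S (x * y)) ->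
  (forall x, S x -> ~ I x) ->
  exists Q, [/\ spec_prime B Q, I `<=` Q & forall x, S x -> ~ Q x].
Proof.
move=> hB sI IB S1 SM SI.
(* Zorn runs on sets [X] added to [I], so that the union of the empty chain still gives an
   admissible submodule, namely [I]. *)
pose P X := [/\ submodule B (I `|` X), I `|` X `<=` B & forall x, S x -> ~ (I `|` X) x].
have [F FP totF|X [[sX XB SX] Xmax]] := @Zorn_bigcup K P.
  have pair x y : (I `|` \bigcup_(X in F) X) x -> (I `|` \bigcup_(X in F) X) y ->
      (exists2 X, P X & ((I `|` X) x /\ (I `|` X) y) /\
         (I `|` X `<=` I `|` \bigcup_(X in F) X)).
    have sub X : F X -> I `|` X `<=` I `|` \bigcup_(X in F) X.
      by move=> FX z [Iz|Xz]; [left|right; exists X].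
    have P0 : P set0 by rewrite /P setU0.
    move=> [Ix|[X FX Xx]] [Iy|[Y FY Yy]].
    - by exists set0 => //; split; [split; left|rewrite setU0; left].
    - by exists Y; [exact: FP|split; [split; [left|right]|exact: sub]].
    - by exists X; [exact: FP|split; [split; [right|left]|exact: sub]].
    - have [XY|YX] := totF _ _ FX FY.
      + by exists Y; [exact: FP|split; [split; right => //; apply: XY|exact: sub]].
      + by exists X; [exact: FP|split; [split; right => //; apply: YX|exact: sub]].
  split.
  - split; first by left; case: sI.
    + move=> x y Ux Uy; have [X [[_ XD _] _ _] [[Xx Xy] XU]] := pair x y Ux Uy.
      by apply/XU/XD.
    + move=> b x Bb Ux; have [X [[_ _ XZ] _ _] [[Xx _] XU]] := pair x x Ux Ux.
      by apply/XU/XZ.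
  - by move=> x Ux; have [X [_ XB _] [[Xx _] _]] := pair x x Ux Ux; apply: XB.
  - by move=> x Sx Ux; have [X [_ _ XS] [[Xx _] _]] := pair x x Ux Ux; apply: XS Sx Xx.
pose Q := I `|` X.
have B1 : B 1 by case: hB.
have BM x y : B x -> B y -> B (x * y) by case: hB => _ _; apply.
exists Q; split => //; [|by left].
split=> //; first by move=> e; apply: (SX 1 S1); rewrite -/Q e.
have meets z : B z -> ~ Q z -> exists s q b, [/\ S s, Q q, B b & s = q + b * z].
  move=> Bz nz; pose Y := [set w | exists2 q, Q q & exists2 b, B b & w = q + b * z].
  have [Q0 QD QZ] := sX.
  have B0 := (subring_add hB).1.
  have QY : Q `<=` Y by move=> q Qq; exists q => //; exists 0; rewrite // mul0r addr0.
  have eY : I `|` Y = Y by rewrite predeqE => w; split=> [[Iw|//]|]; [apply: QY; left|right].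
  apply: contrapT => hn; apply: (Xmax Y).
    split; last first.
      move=> YX; apply: nz; right; apply: YX; exists 0 => //; exists 1; rewrite // add0r mul1r //.
    by move=> x Xx; apply: QY; right.
  rewrite /P eY; split.
  - split; first exact: QY.
    + move=> _ _ [q Qq [b Bb ->]] [r Qr [c Bc ->]]; exists (q + r); first exact: QD.
      by exists (b + c); [apply: add_closedD => //; exact: subring_add|ring].
    + move=> a _ Ba [q Qq [b Bb ->]]; exists (a * q); first exact: QZ.
      by exists (a * b); [exact: BM|ring].
  - move=> _ [q Qq [b Bb ->]]; apply: add_closedD; [exact: subring_add|exact: XB|exact: BM].
  - by move=> s Ss [q Qq [b Bb e]]; apply: hn; exists s, q, b.
move=> x y Bx By Qxy; apply: contrapT => /not_orP[nx ny].
have [s [q [b [Ss Qq Bb es]]]] := meets x Bx nx.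
have [s' [q' [b' [Ss' Qq' Bb' es']]]] := meets y By ny.
apply: (SX _ (SM _ _ Ss Ss')); rewrite es es' mulrDl.
have [_ QD QZ] := sX; apply: (QD).
  rewrite mulrC; apply: QZ => //; apply: add_closedD; [exact: subring_add|exact: XB|exact: BM].
rewrite mulrDr; apply: QD; first by apply: QZ => //; apply: BM.
by rewrite mulrACA; apply: QZ => //; apply: BM.
Qed.

(** * Height one and divisibility of powers *)

Section HeightOne.
Variables (K : fieldType) (A M : set K).
Hypotheses (hA : subring A)
  (hK : forall x, exists a b, [/\ A a, A b, b != 0 & x = a / b])
  (hM : spec_prime A M).

Definition minimal_prime : Prop := forall Q, spec_prime A Q -> Q `<=` M ->
  (exists2 x, Q x & x != 0) -> Q = M.

Lemma zero_prime : spec_prime A [set 0].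
Proof.
split.
- split=> [//|x y -> ->|a x _ ->]; by rewrite /= ?addr0 ?mulr0.
- by move=> x ->; exact: (subring_add hA).1.
- have A1 : A 1 by case: hA.
  by move=> e; move: A1; rewrite -e => /= /eqP; rewrite oner_eq0.
- by move=> x y _ _ /= /eqP; rewrite mulf_eq0 => /orP[]/eqP ->; [left|right].
Qed.

Lemma height_one_minimal : has_height A M 1 -> minimal_prime.
Proof.
move=> [_ hmax] Q hQ QM [x Qx x0]; apply: contrapT => QnM.
pose C (i : nat) := if i is 0%N then [set 0] else if i is 1%N then Q else M.
suff /hmax : prime_chain A M 2 C by [].
split=> [[|[|i]] _ //|[|[|i]]//|//]; first exact: zero_prime.
move=> _ /=; split; first by move=> y ->; case: hQ => -[].
by move=> e; move: Qx; rewrite -e => /= /eqP; apply/negP.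
Qed.

Lemma minimal_height_one : (exists2 x, M x & x != 0) -> minimal_prime -> has_height A M 1.
Proof.
move=> [x Mx x0] hmin; split.
  exists (fun i => if i is 0%N then [set 0] else M); split=> // [[|i] _ //|[|i]//].
    exact: zero_prime.
  move=> _; split; first by move=> y ->; case: hM => -[].
  by move=> e; move: Mx; rewrite -e => /= /eqP; apply/negP.
move=> m C [hp hi hm]; rewrite leqNgt; apply/negP => m2.
case: m m2 hp hi hm => [|[|m]] // _ hp hi hm.
have [sub1 ne1] := hi m (leqnSn _).
have [sub2 ne2] := hi m.+1 (leqnn _); rewrite hm in sub2 ne2.
apply: ne2; apply: hmin => //; first exact: hp.
apply: contrapT => hn; apply: ne1; rewrite predeqE => y; split; first exact: sub1.
move=> Cy; case: (eqVneq y 0) => [->|y0]; last by case: hn; exists y.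
by have [[]] := hp m (leq_trans (leqnSn _) (leqnSn _)).
Qed.

Hypothesis hmin : minimal_prime.

(** Otherwise, [t] being replaced by its numerator, a prime contains [t] and avoids all [s * y ^+ n]
    with [s] outside [M]. It is nonzero and inside [M], hence equal to [M], yet it omits [y]. *)
Lemma height_one_arch y t : M y -> t != 0 -> exists n, loc A M A (y ^+ n / t).
Proof.
move=> My; have [sM MA _ Mp] := hM.
have A1 : A 1 by case: hA.
have AM a b : A a -> A b -> A (a * b) by case: hA => _ _; apply.
wlog At : t / A t => [hw t0|t0].
  have [a [b [Aa Ab b0 et]]] := hK t.
  have a0 : a != 0 by apply: contra t0; rewrite et => /eqP ->; rewrite mul0r.
  have [n hn] := hw a Aa a0; exists n.
  have -> : y ^+ n / t = b * (y ^+ n / a) by rewrite et; field; rewrite a0.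
  by have [_ _] := loc_submodule hA hM (ring_submodule hA); apply.
apply: contrapT => /forallNP hn.
pose S := [set z | exists s n, [/\ A s, ~ M s & z = s * y ^+ n]].
have [|_ [a Aa <-]||x x' [s [n [As ns ->]]] [s' [n' [As' ns' ->]]]|z [s [n [As ns ->]]]|] :=
  @prime_avoiding K A S [set t * a | a in A] hA.
- split.
  + by exists 0; rewrite ?mulr0 //; exact: (subring_add hA).1.
  + move=> _ _ [a Aa <-] [b Ab <-]; exists (a + b); last by rewrite mulrDr.
    by apply: add_closedD => //; exact: subring_add.
  + by move=> c _ Ac [a Aa <-]; exists (c * a); [exact: AM|rewrite mulrCA].
- exact: AM.
- by exists 1, 0%N; split=> //; [exact: (prime1 hM)|rewrite mulr1].
- exists (s * s'), (n + n')%N; split; [exact: AM|exact: (primeM hM)|].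
  by rewrite exprD mulrACA.
- move=> [a Aa e]; apply: (hn n); exists s; split=> //.
  by rewrite mulrA -e mulrAC divff ?mul1r.
move=> Q [hQ IQ SQ].
have QM : Q = M.
  apply: hmin => //; last by exists t => //; apply: IQ; exists 1; rewrite ?mulr1.
  move=> x Qx; apply: contrapT => nx; apply: (SQ x) => //.
  exists x, 0%N; split=> //; last by rewrite mulr1.
  by case: hQ => _ QA _ _; apply: QA.
apply: (SQ y); last by rewrite QM.
by exists 1, 1%N; split=> //; [exact: (prime1 hM)|rewrite mul1r].
Qed.

End HeightOne.

(** * Invertibility from Clifford regularity, and regularity from stability *)

Section Regular.
Variables (K : fieldType) (A : set K) (star : set K -> set K).
Hypothesis h : spectral_setting A star.
Implicit Types I J H M : set K.

Let hA : subring A := setting_ring h.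
Let hK := setting_frac h.
Let hS := setting_star h.
Local Notation D := (intclosure A star).

(* With [G = I J] the regularity identity localizes to [I R_M = G I R_M], so
   that the determinant trick puts [1] in [G R_M]. *)
Lemma regular_invertible M n (a : 'I_n -> K) : clifford_star_regular A star ->
  star_max A star M -> (exists i, a i != 0) ->
  exists c, \sum_i a i * c i = 1 /\ forall i j, loc A M D (a i * c j).
Proof.
move=> hreg mM ha; have pM := star_max_prime h mM.
set I := span A a; have iI : ideal A I := span_ideal hA hK ha.
have fI : fg_ideal A I := span_fg_ideal hA hK ha.
have Ia i : I (a i) by exact: span_gen.
have [J iJ e] := hreg I iI.
pose G := ideal_mul I J; pose L := ideal_mul (ideal_mul I I) J.
have iL : ideal A L by do 2?apply: ideal_mul_ideal.
have sG : submodule A G by apply: ideal_mul_submodule; case: iI.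
have gL g y : G g -> I y -> L (g * y).
  move=> Gg Iy; apply: (@ideal_mul_sub _ I J [set g | L (g * y)]) Gg.
    have [L0 LB] : add_closed L by apply: submodule_add hA _; case: iL.
    by split=> [/=|u v /= ? ?]; [rewrite mul0r|rewrite mulrBl; apply: LB].
  by move=> x z Ix Jz /=; rewrite mulrAC; apply: ideal_mul_gen => //; apply: ideal_mul_gen.
have gI g y : G g -> I y -> star I (g * y).
  by move=> Gg Iy; rewrite e; apply: (star_extensive hS iL); apply: gL.
(* [G] maps [I] into [star I], so it stabilizes the closure of a finitely generated ideal. *)
have GD : G `<=` D.
  by move=> g Gg; exists I => //; apply: (star_colon h iI iI) => y; apply: gI.
have aL i : exists N : 'I_n -> K, (forall j, loc A M G (N j)) /\ a i = \sum_j N j * a j.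
  have [s [As ns]] : loc A M L (a i).
    have : star L (a i) by rewrite -e; apply: star_extensive hS _ iI _ (Ia i).
    by move/(starE h _ iL); apply.
  have s0 := notin_prime_neq0 pM ns.
  pose W := [set z | exists2 N : 'I_n -> K, (forall j, G (N j)) & z = \sum_j N j * a j].
  have [G0 GB] := submodule_add hA sG.
  have aW : add_closed W.
    split; first by exists (fun=> 0) => //; rewrite big1 // => j _; rewrite mul0r.
    move=> _ _ [N hN ->] [N' hN' ->]; exists (fun j => N j - N' j) => [j|]; first exact: GB.
    by rewrite -sumrB; apply: eq_bigr => j _; rewrite mulrBl.
  move=> La; have : W (s * a i).
    apply: (ideal_mul_sub aW _ La) => xy z hxy Jz.
    apply: (@ideal_mul_sub _ I I [set u | W (u * z)]) hxy.
      split=> [/=|u v /= ? ?]; first by rewrite mul0r; exact: aW.1.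
      by rewrite mulrBl; apply: aW.2.
    move=> x _ Ix [c Ac ->] /=; exists (fun j => c j * (x * z)) => [j|].
      by case: sG => _ _; apply => //; apply: ideal_mul_gen.
    by rewrite mulrAC mulrC mulr_suml; apply: eq_bigr => j _; ring.
  move=> [N hN eN]; exists (fun j => N j / s); split=> [j|].
    by exists s; split=> //; rewrite mulrC divfK.
  apply: (mulfI s0); rewrite eN mulr_sumr; apply: eq_bigr => j _.
  by field.
have /choice[N hN] := aL.
have G1 : loc A M G 1.
  rewrite -(expr1n _ n).
  apply: (@det_trick _ _ _ _ N a (loc_add hA pM sG)) => //.
  - move=> u v [s [As ns Gu]] [r [Ar nr Gv]].
    apply/(loc_unit hA pM As ns)/(loc_unit hA pM Ar nr).
    have -> : r * (s * (u * v)) = s * u * (r * v) by ring.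
    have aG := loc_add hA pM sG.
    apply: (@ideal_mul_sub _ I J [set w | loc A M G (s * u * w)]) Gv.
      split=> [/=|w w' /= ? ?]; first by rewrite mulr0; exact: aG.1.
      by rewrite mulrBr; apply: aG.2.
    move=> x z Ix Jz /=; rewrite mulrA.
    have hI : loc A M I (s * u * x) by move/(starE h _ iI): (gI _ _ Gu Ix); apply.
    apply: (locM hA pM _ hI (sub_loc hA pM (erefl : [set z] z))).
    by move=> p _ Ip ->; apply: ideal_mul_gen.
  - by move=> x; rewrite mul1r.
  - by move=> i j; case: (hN i).
  - by move=> i; rewrite mul1r; case: (hN i).
have [s [As ns Gs]] := G1; rewrite mulr1 in Gs.
have s0 := notin_prime_neq0 pM ns.
have [J0 JB] : add_closed J by apply: submodule_add hA _; case: iJ.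
(* As [s] lies in [I J], collecting terms along the generators writes it as [\sum_j a j * c j] with
   [c j] in [J]; dividing by [s] gives the inverse. *)
pose W := [set z | exists2 c : 'I_n -> K, (forall j, J (c j)) & z = \sum_j a j * c j].
have [c Jc es] : W s.
  apply: (@ideal_mul_sub _ I J) Gs.
    split; first by exists (fun=> 0) => //; rewrite big1 // => j _; rewrite mulr0.
    move=> _ _ [c hc ->] [c' hc' ->]; exists (fun j => c j - c' j) => [j|]; first exact: JB.
    by rewrite -sumrB; apply: eq_bigr => j _; rewrite mulrBr.
  move=> _ z [c Ac ->] Jz; exists (fun j => c j * z) => [j|].
    by case: iJ => -[_ _ JZ] _ _; apply: JZ.
  by rewrite mulr_suml; apply: eq_bigr => j _; ring.
exists (fun j => c j / s); split=> [|i j].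
  by under eq_bigr => j _ do rewrite mulrA; rewrite -mulr_suml -es divff.
exists s; split=> //; have -> : s * (a i * (c j / s)) = a i * c j by field.
by apply: GD; apply: ideal_mul_gen.
Qed.

Lemma star_colon_ideal I : ideal A I -> ideal A (colon (star I) (star I)).
Proof. by move=> /(star_ideal_closed hS) iI; apply: colon_ideal. Qed.

Lemma loc_mul_star I J M x : ideal A I -> ideal A J -> star_max A star M ->
  loc A M (ideal_mul (star I) J) x -> loc A M (ideal_mul I J) x.
Proof.
move=> iI iJ mM [s [As ns hs]]; have pM := star_max_prime h mM.
apply: (loc_unit hA pM As ns).
apply: (ideal_mul_sub _ _ hs); first by apply: loc_add => //; apply: ideal_mul_submodule; case: iI.
move=> a b /(starE h _ iI)/(_ M mM) la Jb.
apply: (locM hA pM _ la (sub_loc hA pM (erefl : [set b] b))).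
by move=> p _ Ip ->; apply: ideal_mul_gen.
Qed.

(** With [J] equal to [(E : star I)], stability puts [1] in [I J] locally, so [I] lies in the
    closure of [I^2 J]; conversely [I J] lies in [E], which maps [I] into [star I]. *)
Lemma stable_regular : star_stable A star -> clifford_star_regular A star.
Proof.
move=> hst I iI; set E := colon (star I) (star I).
have isI := star_ideal_closed hS iI.
have iE : ideal A E by exact: star_colon_ideal.
have iJ : ideal A (colon E (star I)) by exact: colon_ideal.
exists (colon E (star I)) => //; set J := colon E (star I) in iJ *.
have iL : ideal A (ideal_mul (ideal_mul I I) J) by do 2?apply: ideal_mul_ideal.
have Isub := star_extensive hS iI.
have E1 : E 1 by move=> y; rewrite mul1r.
rewrite predeqE => x; split.
  move=> /(starE h _ iI) hx; apply/(starE h _ iL) => M mM; have pM := star_max_prime h mM.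
  have : star (ideal_mul (star I) J) 1 by have := hst I iI; rewrite /star_stable_ideal -/E => ->.
  move/(starE h _ (ideal_mul_ideal hA isI iJ))/(_ M mM)/(loc_mul_star iI iJ mM) => h1.
  rewrite -[x]mulr1; apply: (locM hA pM _ (hx M mM) h1) => a b Ia hb.
  apply: (@ideal_mul_sub _ I J [set b | ideal_mul (ideal_mul I I) J (a * b)]) hb.
    have [L0 LB] : add_closed (ideal_mul (ideal_mul I I) J) by apply: submodule_add hA _; case: iL.
    by split=> [/=|u v /= ? ?]; [rewrite mulr0|rewrite mulrBr; apply: LB].
  by move=> y z Iy Jz /=; rewrite mulrA; apply: ideal_mul_gen => //; apply: ideal_mul_gen.
move=> hx; rewrite -(star_idempotent hS iI).
apply: (star_monotone hS iL isI) hx.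
have aI : add_closed (star I) by apply: submodule_add hA _; case: isI.
apply: (ideal_mul_sub aI) => w z hw Jz.
apply: (@ideal_mul_sub _ I I [set w | star I (w * z)]) hw.
  by split=> [/=|u v /= ? ?]; [rewrite mul0r; exact: aI.1|rewrite mulrBl; apply: aI.2].
move=> a b Ia Ib /=; rewrite -mulrA mulrC [b * z]mulrC.
by apply: (Jz b) => //; apply: Isub.
Qed.

End Regular.

(** * Discrete valuations *)

Section Valuations.
Variables (K : fieldType) (v : K -> int).
Hypothesis hv : discrete_valuation v.

(** As [v 0] is arbitrary, [0] is put in by hand. Levels [0] and [1] are the valuation ring and its
    maximal ideal. *)
Definition vge (k : int) : set K := [set x | x = 0 \/ k <= v x].

Let vM x y : x != 0 -> y != 0 -> v (x * y) = v x + v y.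
Proof. by case: hv => + _ _; apply. Qed.

Lemma val1 : v 1 = 0.
Proof.
have : v (1 * 1) = v 1 + v 1 by apply: vM; exact: oner_neq0.
by rewrite mulr1; lia.
Qed.

Lemma valV x : x != 0 -> v x^-1 = - v x.
Proof.
move=> x0; have : v (x / x) = v x + v x^-1 by apply: vM; rewrite ?invr_eq0.
by rewrite divff // val1; lia.
Qed.

Lemma valX x n : x != 0 -> v (x ^+ n) = v x * n%:Z.
Proof.
move=> x0; elim: n => [|n IH]; first by rewrite expr0 val1 mulr0.
by rewrite exprS vM ?expf_neq0 // IH; lia.
Qed.

Lemma valN x : v (- x) = v x.
Proof.
case: (eqVneq x 0) => [->|x0]; first by rewrite oppr0.
have n1 : (-1 : K) != 0 by rewrite oppr_eq0 oner_neq0.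
have := vM n1 n1; rewrite mulrNN mulr1 val1 => e.
by rewrite -mulN1r vM //; lia.
Qed.

Lemma vge_add k : add_closed (vge k).
Proof.
split=> [|x y]; first by left.
have vN z : vge k z -> vge k (- z).
  by case=> [->|hz]; [left; rewrite oppr0|right; rewrite valN].
move=> hx /vN; move: (- y) => {}y [->|hy]; first by rewrite addr0.
case: hx => [->|hx]; first by rewrite add0r; right.
case: (eqVneq x 0) => [->|x0]; first by rewrite add0r; right.
case: (eqVneq y 0) => [->|y0]; first by rewrite addr0; right.
case: (eqVneq (x + y) 0) => [->|xy0]; [by left|right].
by case: hv => _ /(_ _ _ x0 y0 xy0) hm _; apply: le_trans hm; rewrite le_min hx hy.
Qed.

Lemma vgeM j k x y : vge j x -> vge k y -> vge (j + k) (x * y).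
Proof.
case: (eqVneq x 0) => [->|x0]; first by rewrite mul0r; left.
case: (eqVneq y 0) => [->|y0]; first by rewrite mulr0; left.
move=> [/eqP|hx]; first by rewrite (negPf x0).
move=> [/eqP|hy]; first by rewrite (negPf y0).
by right; rewrite vM // lerD.
Qed.

Lemma vge0M x y : vge 0 x -> vge 0 y -> vge 0 (x * y).
Proof. by move=> hx hy; rewrite -(addr0 (0 : int)); apply: vgeM. Qed.

Lemma vge1M x y : vge 1 x -> vge 0 y -> vge 1 (x * y).
Proof. by move=> hx hy; rewrite -(addr0 (1 : int)); apply: vgeM. Qed.

Lemma vge1_not1 : ~ vge 1 1.
Proof. by case=> [/eqP|]; rewrite ?oner_eq0 // val1. Qed.

Lemma vge_le j k x : j <= k -> vge k x -> vge j x.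
Proof. by move=> jk [->|hx]; [left|right; apply: le_trans hx]. Qed.

Lemma vge_cancel k a x : a != 0 -> v a = 0 -> vge k (a * x) -> vge k x.
Proof.
move=> a0 va [/eqP|hx]; first by rewrite mulf_eq0 (negPf a0) => /eqP ->; left.
case: (eqVneq x 0) => [->|x0]; [by left|right].
by move: hx; rewrite vM // va add0r.
Qed.

Lemma vge_nz k x : x != 0 -> vge k x -> k <= v x.
Proof. by move=> x0 [e|//]; rewrite e eqxx in x0. Qed.

End Valuations.

Lemma finite_set_list (T : Type) (F : set T) : finite_set F ->
  exists s : seq {classic T}, forall l, F l -> l \in s.
Proof.
move=> hF; have /finite_seqP[s es] : finite_set (F : set {classic T}) by [].
by exists s => l; rewrite es.
Qed.

(** * From regularity with a Krull closure to stability and dimension one *)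

Section RegularKrull.
Variables (K : fieldType) (A : set K) (star : set K -> set K).
Hypotheses (h : spectral_setting A star) (hreg : clifford_star_regular A star).
Local Notation D := (intclosure A star).
Variables (L : Type) (v : L -> K -> int).
Hypotheses (hv : forall l, discrete_valuation (v l))
  (eD : D = \bigcap_l valuation_ring (v l))
  (fin : forall x, x != 0 -> finite_set [set l | v l x != 0]).
Implicit Types I J H M : set K.

Let hA : subring A := setting_ring h.
Let hK := setting_frac h.
Let hS := setting_star h.
Let A1 : A 1. Proof. by case: hA. Qed.
Let AM x y : A x -> A y -> A (x * y). Proof. by case: hA => _ _; apply. Qed.

Lemma krull_vge l x : D x -> vge (v l) 0 x.
Proof. by rewrite eD => /(_ l I). Qed.

Lemma krull_base_vge l x : A x -> vge (v l) 0 x.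
Proof. by move=> /(sub_intclosure h); exact: krull_vge. Qed.

Lemma krull_mem x : (forall l, vge (v l) 0 x) -> D x.
Proof. by rewrite eD => hx l _; exact: hx. Qed.

Lemma krull_bound x : x != 0 -> exists B : nat, forall l, v l x <= B%:Z.
Proof.
move=> x0; have [s hs] := finite_set_list (fin x0).
have [B hB] : exists B : nat, forall l, l \in s -> v l x <= B%:Z.
  elim: {hs} s => [|l s [B hB]]; first by exists 0%N.
  exists (B + `|v l x|)%N => k; rewrite inE => /orP[/eqP ->|/hB]; lia.
exists B => l; case: (eqVneq (v l x) 0) => [->//|n0].
by apply: hB; apply: hs.
Qed.

(** If [v l u] were negative, a high enough power of [u] would outweigh [v l d]. *)
Lemma krull_complete u d : d != 0 -> (forall n, A (d * u ^+ n)) -> D u.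
Proof.
move=> d0 hu; apply: krull_mem => l.
case: (eqVneq u 0) => [->|u0]; [by left|right].
rewrite leNgt; apply/negP => un.
have := krull_base_vge l (hu `|v l d|.+1%N).
move/(vge_nz (mulf_neq0 d0 (expf_neq0 _ u0))).
have [vM _ _] := hv l; rewrite vM ?expf_neq0 // valX //; nia.
Qed.

Section AtM.
Variable M : set K.
Hypothesis mM : star_max A star M.
Let pM := star_max_prime h mM.

(** Since [A] lies in every ring of the family, this says that the ring of [v l] contains the
    localization of [A] at [M]. *)
Definition over_max l : Prop := forall s, A s -> ~ M s -> v l s = 0.

Lemma loc_krull_vge l x : over_max l -> loc A M D x -> vge (v l) 0 x.
Proof.
move=> hl [s [As ns hs]]; apply: (vge_cancel (hv l) (notin_prime_neq0 pM ns) (hl _ As ns)).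
exact: krull_vge.
Qed.

Lemma loc_base_vge l x : over_max l -> loc A M A x -> vge (v l) 0 x.
Proof.
by move=> hl hx; apply: loc_krull_vge hl _; apply: loc_mono hx; apply: sub_intclosure.
Qed.

(** Finitely many values of [x] are nonzero; each one at an [l] not over [M] is repaired by a factor
    outside [M] of positive value at [l]. *)
Lemma loc_krull_mem x : (forall l, over_max l -> vge (v l) 0 x) -> loc A M D x.
Proof.
case: (eqVneq x 0) => [->|x0] hx.
  by case: (loc_submodule hA pM (intclosure_submodule h)).
have [s hs] := finite_set_list (fin x0).
have [r [Ar nr hr]] : exists r, [/\ A r, ~ M r & forall l, l \in s -> vge (v l) 0 (r * x)].
  elim: {hs} s => [|l s [r [Ar nr hr]]]; first by exists 1; split=> //; exact: (prime1 pM).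
  case: (pselect (over_max l)) => hl.
    exists r; split=> // k; rewrite inE => /orP[/eqP ->|/hr//].
    by apply: (vge0M (hv l)); [exact: krull_base_vge|exact: hx].
  have [a [Aa na va]] : exists a, [/\ A a, ~ M a & v l a != 0].
    apply: contrapT => hn; apply: hl => a Aa na; apply/eqP/negPn/negP => va.
    by apply: hn; exists a.
  have a0 := notin_prime_neq0 pM na; have r0 := notin_prime_neq0 pM nr.
  exists (a ^+ `|v l x| * r); split.
  - by apply: AM => //; apply: subringX.
  - by apply: (primeM pM) => //; [apply: subringX|apply: (primeX hA pM)].
  move=> k; rewrite inE -mulrA => /orP[/eqP ->|/hr hk].
    right; have [vM _ _] := hv l; rewrite !vM ?valX ?mulf_neq0 ?expf_neq0 //.
    have := vge_nz a0 (krull_base_vge l Aa); have := vge_nz r0 (krull_base_vge l Ar).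
    nia.
  by apply: (vge0M (hv k)) => //; apply: krull_base_vge; apply: subringX.
exists r; split=> //; apply: krull_mem => l.
case: (eqVneq (v l x) 0) => [vx|n0]; last by apply: hr; apply: hs.
by apply: (vge0M (hv l)); [exact: krull_base_vge|right; rewrite vx].
Qed.

Lemma regular_pair a b : (a != 0) || (b != 0) ->
  exists c d, [/\ a * c + b * d = 1, loc A M D (a * c), loc A M D (a * d),
                loc A M D (b * c) & loc A M D (b * d)].
Proof.
move=> hab; pose g (i : 'I_2) := if i == ord0 then a else b.
have [|c [e hc]] := regular_invertible h hreg mM (a := g).
  by case/orP: hab => [a0|b0]; [exists ord0|exists ord_max].
exists (c ord0), (c ord_max); split.
- by rewrite -e big_ord_recl big_ord1 /=; do !congr (_ * c _ + _); congr (_ * c _); apply: val_inj.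
- exact: (hc ord0 ord0).
- exact: (hc ord0 ord_max).
- exact: (hc ord_max ord0).
- exact: (hc ord_max ord_max).
Qed.

(** The aim is an [e] of positive value at [l] that is a unit at every valuation over [M] where [y]
    is not. Then in [e * c' + y * d' = 1] the factors [c'] and [d'] belong to the localized closure,
    and [d'] inverts [y] modulo the maximal ideal at [l]. *)
Lemma residue_inverse l y : over_max l -> A y -> y != 0 -> v l y = 0 ->
  exists2 z, loc A M D z & vge (v l) 1 (1 - y * z).
Proof.
move=> hl Ay y0 vy.
have [x0 [Ax x00 vx]] : exists x0, [/\ A x0, x0 != 0 & 1 <= v l x0].
  have [_ _ /(_ 1)[p p0 vp]] := hv l.
  have [a [b [Aa Ab b0 ep]]] := hK p.
  have a0 : a != 0 by apply: contra p0; rewrite ep => /eqP ->; rewrite mul0r.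
  exists a; split=> //.
  have := vge_nz b0 (krull_base_vge l Ab).
  by move: vp; rewrite ep; case: (hv l) => vM _ _; rewrite vM ?invr_eq0 // (valV (hv l)) //; lia.
have [B hB] := krull_bound x00.
have yB0 : y ^+ B.+1 != 0 by rewrite expf_neq0.
(* [B] bounds all values of [x0]: where [y] is a nonunit, [y ^+ B.+1] has larger value than [x0], so
   [1 - e] is positive there. At [l], where [y] is a unit, [c] is integral and [e] inherits
   positivity from [x0]. *)
have [c [d [e1 lxc lxd lyc lyd]]] := @regular_pair x0 (y ^+ B.+1) (introT orP (or_introl x00)).
pose e := x0 * c.
have ve : vge (v l) 1 e.
  apply: (vge1M (hv l)); first by right.
  apply: (vge_cancel (hv l) yB0); first by rewrite (valX (hv l)) // vy mul0r.
  exact: loc_krull_vge.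
have he k : over_max k -> v k y != 0 -> e != 0 /\ v k e = 0.
  move=> hk ky.
  have vy1 : 1 <= v k y by have := vge_nz y0 (krull_base_vge k Ay); lia.
  have f1 : vge (v k) 1 (y ^+ B.+1 * d).
    have -> : y ^+ B.+1 * d = (y ^+ B.+1 / x0) * (x0 * d) by field.
    apply: (vge1M (hv k)); last exact: loc_krull_vge.
    right; case: (hv k) => vM _ _; rewrite vM ?invr_eq0 // (valV (hv k)) // (valX (hv k)) //.
    have := hB k; nia.
  have ne1 : ~ vge (v k) 1 e.
    move=> ee; apply: (vge1_not1 (hv k)); rewrite -e1.
    exact: add_closedD (vge_add (hv k) 1) ee f1.
  have e0 : e != 0 by apply/eqP => ee; apply: ne1; left.
  split=> //; have := vge_nz e0 (loc_krull_vge hk lxc).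
  have : ~ (1 <= v k e) by move=> ?; apply: ne1; right.
  lia.
have [c' [d' [e2 lec led lyc' lyd']]] := @regular_pair e y (introT orP (or_intror y0)).
have in_loc x : loc A M D (e * x) -> loc A M D (y * x) -> loc A M D x.
  move=> ex yx; apply: loc_krull_mem => k hk.
  case: (eqVneq (v k y) 0) => [ky|ky].
    by apply: (vge_cancel (hv k) y0 ky); apply: loc_krull_vge.
  by have [e0 ke] := he k hk ky; apply: (vge_cancel (hv k) e0 ke); apply: loc_krull_vge.
exists d'; first exact: in_loc.
rewrite -e2 addrK; apply: (vge1M (hv l)) => //.
by apply: loc_krull_vge => //; apply: in_loc.
Qed.

(* The elements of [D_M] whose residue at [l] is that of an element of [M R_M]
   serve as [H] in the determinant trick. *)
Lemma no_residue_inverse l y z : over_max l -> M y -> loc A M D z ->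
  ~ vge (v l) 1 (1 - y * z).
Proof.
move=> hl My hz hyz.
have [sM MA _ _] := pM.
have aM := loc_add hA pM sM.
pose H := [set x | exists2 r, loc A M M r & vge (v l) 1 (x - r)].
have M0 r : loc A M M r -> vge (v l) 0 r.
  by move=> hr; apply: (loc_base_vge hl); apply: loc_mono hr.
have v1 := vge_add (hv l) 1.
have [m [t [ht /(_ ord0)[N hN eN]]]] := loc_intclosure_common h mM (x := fun _ : 'I_1 => z) (fun=> hz).
have : H (1 ^+ m).
  (* From [z t = N t] follows [t = (1 - y z) t + y N t], a matrix with entries in [H]. *)
  apply: (@det_trick _ H _ _ (fun i j => (1 - y * z) *+ (i == j) + y * N i j) t) => //.
  - split; first by exists 0; [exact: aM.1|rewrite subrr; left].
    move=> a b [r hr ar] [s hs bs]; exists (r - s); first exact: aM.2.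
    have -> : a - b - (r - s) = (a - r) - (b - s) by ring.
    exact: v1.2.
  - move=> a b [r hr ar] [s hs bs]; exists (r * s).
      by apply: (locM hA pM) hr hs => a' b' /MA Aa; case: sM => _ _; apply.
    have -> : a * b - r * s = (a - r) * b + (b - s) * r by ring.
    have vb : vge (v l) 0 b.
      rewrite -[b](subrK s); apply: add_closedD; [exact: vge_add|exact: vge_le bs|exact: M0].
    apply: add_closedD => //.
      exact: (vge1M (hv l)).
    by apply: (vge1M (hv l)) => //; apply: M0.
  - by move=> a; rewrite mul1r.
  - move=> i j; exists (y * N i j).
      by rewrite mulrC; apply: (locZ hA pM) => //; apply: sub_loc.
    by rewrite addrK; case: (i == j); [rewrite mulr1n|rewrite mulr0n; left].
  - move=> i; rewrite mul1r; under eq_bigr => j _ do rewrite mulrDl -mulrA.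
    rewrite big_split /= -mulr_sumr -eN (bigD1 i) //= eqxx big1 => [|j /negPf].
      by rewrite mulr1n addr0; ring.
    by rewrite eq_sym => ->; rewrite mulr0n mul0r.
rewrite expr1n => -[r [s [As ns Msr]] h1].
(* [1 - r] has positive value at [l], but [s * (1 - r)] is in [A] outside [M] and so has value
   zero. *)
have nssr : ~ M (s * (1 - r)).
  move=> hs; apply: ns; rewrite -[s](subrK (s * r)); case: sM => _ MD _; apply: MD => //.
  by rewrite mulrBr mulr1 in hs.
have Assr : A (s * (1 - r)).
  by rewrite mulrBr mulr1; apply: (subring_add hA).2 => //; apply: MA.
have s0 := notin_prime_neq0 pM ns; have sr0 := notin_prime_neq0 pM nssr.
have : vge (v l) (0 + 1) (s * (1 - r)) by apply: (vgeM (hv l)) => //; apply: krull_base_vge.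
by move/(vge_nz sr0); rewrite (hl _ Assr nssr).
Qed.

Lemma max_val_gt0 l y : over_max l -> M y -> y != 0 -> 1 <= v l y.
Proof.
move=> hl My y0; have Ay : A y by case: pM => _ MA _ _; apply: MA.
have := vge_nz y0 (krull_base_vge l Ay).
case: (eqVneq (v l y) 0) => [vy|]; last by lia.
have [z lz hz] := residue_inverse hl Ay y0 vy.
by have := no_residue_inverse hl My lz.
Qed.

Lemma sub_max_minimal P : spec_prime A P -> P `<=` M -> minimal_prime A P.
Proof.
move=> hP PM Q hQ QP [x Qx x0]; rewrite predeqE => y; split; first exact: QP.
move=> Py; apply: contrapT => ny.
have [sQ QA _ Qp] := hQ.
have Ay : A y by case: hP => _ PA _ _; apply: PA.
have y0 : y != 0 by apply/eqP => e; apply: ny; rewrite e; case: sQ.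
have [B hB] := krull_bound x0.
(* Over [M], [y] has value at least 1 and [x] at most [B]. The quotient is thus integral, with some
   matrix [N], so [y ^+ B] acts through [x N], whose entries lie in the localization of [Q]. *)
have lz : loc A M D (y ^+ B / x).
  apply: loc_krull_mem => l hl; right; case: (hv l) => vM _ _.
  rewrite vM ?invr_eq0 ?expf_neq0 // (valV (hv l)) // (valX (hv l)) //.
  have := max_val_gt0 hl (PM _ Py) y0; have := hB l; nia.
have [m [t [ht /(_ ord0)[N hN eN]]]] := loc_intclosure_common h mM (x := fun _ : 'I_1 => _) (fun=> lz).
have lQ : loc A M Q ((y ^+ B) ^+ m).
  apply: (@det_trick _ _ _ _ (fun i j => N i j * x) t (loc_add hA pM sQ)) => //.
  - move=> a b ha hb; apply: (locZ hA pM) => //; apply: loc_mono ha; exact: QA.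
  - by move=> a; apply: (locZ hA pM) => //; apply: sub_loc => //; apply: subringX.
  - by move=> i j; apply: (locZ hA pM) => //; apply: sub_loc.
  move=> i; under eq_bigr => j _ do rewrite mulrAC.
  by rewrite -mulr_suml -eN; field.
have QyB : Q (y ^+ (B * m)).
  rewrite exprM; apply: (loc_prime hQ (subset_trans QP PM)) lQ.
  by do 2?apply: subringX.
exact: (primeX hA hQ Ay ny) QyB.
Qed.

End AtM.

(** [1] is not in [star P]; by [starE] this is witnessed at some [M], which must then contain
    [P]. *)
Lemma prime_below_max P : star_prime A star P ->
  exists2 M, star_max A star M & P `<=` M.
Proof.
move=> [[iP [sP PA PnA _]] [_ eP]]; apply: contrapT => hn.
apply: PnA; rewrite predeqE => x; split; first exact: PA.
suff P1 : P 1 by move=> Ax; rewrite -[x]mulr1; case: sP => _ _; apply.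
rewrite -eP; apply/(starE h _ iP) => M mM; apply: contrapT => h1; apply: hn.
exists M => // p Pp; apply: contrapT => np; apply: h1; exists p.
by rewrite mulr1; split=> //; apply: PA.
Qed.

Lemma regular_krull_dim1 : star_dimension_one A star.
Proof.
move=> P hP; have [M mM PM] := prime_below_max hP.
have [[iP sP] _] := hP.
apply: minimal_height_one => //; first by case: iP.
exact: sub_max_minimal mM _ sP PM.
Qed.

(** Every [u ^+ n * x] stays in [J], so [d * x] is a common denominator for the powers of [u]. *)
Lemma colon_krull J : ideal A J -> colon J J `<=` D.
Proof.
move=> iJ u hu; have [sJ [x Jx x0] [d [Ad d0 dJ]]] := iJ.
apply: (@krull_complete u (d * x)); first by rewrite mulf_neq0.
move=> n; rewrite -mulrA [x * _]mulrC; apply: dJ.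
elim: n => [|n IH]; first by rewrite expr0 mul1r.
by rewrite exprS -mulrA; apply: hu.
Qed.

(* With [I'] the star closure of [I], [H = I' (E : I')] is idempotent at [M].
   At each valuation above [M] it contains a unit, since otherwise an element
   of least value would lie in [H^2]; hence [H] extends to the unit ideal of
   [D_M], and lying over applies. *)
Lemma regular_krull_stable : star_stable A star.
Proof.
move=> I iI; rewrite /star_stable_ideal; set E := colon (star I) (star I).
have isI := star_ideal_closed hS iI.
have iE : ideal A E by exact: star_colon_ideal.
have sI := star_submodule h iI.
have iC : ideal A (colon E (star I)) by exact: colon_ideal.
set C := colon E (star I) in iC *.
set H := ideal_mul (star I) C.
have iH : ideal A H by exact: ideal_mul_ideal.
have HE : H `<=` E.
  apply: ideal_mul_sub; first by apply: submodule_add hA _; case: iE.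
  by move=> a c ha hc; rewrite mulrC; apply: hc.
have sH : submodule A H by case: iH.
have HM x y : H x -> H y -> H (x * y).
  move=> /HE Ex; apply: (@ideal_mul_sub _ (star I) C [set y | H (x * y)]).
    have [H0 HB] := submodule_add hA sH.
    by split=> [/=|a b /= ? ?]; [rewrite mulr0|rewrite mulrBr; apply: HB].
  by move=> a c ha hc /=; rewrite mulrA; apply: ideal_mul_gen => //; apply: Ex.
have sE : star E = E.
  rewrite predeqE => x; split; last exact: star_extensive hS _ iE x.
  move=> hx y Iy; rewrite mulrC -(star_idempotent hS iI).
  apply: (star_colon h iE isI _ hx) => e Ee.
  by rewrite (star_idempotent hS iI) mulrC; apply: Ee.
suff H1 M : star_max A star M -> loc A M H 1.
  rewrite predeqE => x; split.
    by move=> hx; rewrite -sE; apply: (star_monotone hS iH iE HE hx).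
  move=> Ex; apply/(starE h _ iH) => M mM.
  have [s [As ns Hs]] := H1 M mM; exists s; split=> //.
  rewrite mulr1 in Hs; apply: (@ideal_mul_sub _ (star I) C [set y | H (y * x)]) Hs.
    have [H0 HB] := submodule_add hA sH.
    by split=> [/=|a b /= ? ?]; [rewrite mul0r|rewrite mulrBl; apply: HB].
  move=> a c ha hc /=; rewrite mulrAC; apply: ideal_mul_gen => //.
  by rewrite mulrC; apply: Ex.
move=> mM; have pM := star_max_prime h mM.
have [J iJ eJ] := hreg iI.
have iL : ideal A (ideal_mul (ideal_mul I I) J) by do 2?apply: ideal_mul_ideal.
have Isub := star_extensive hS iI.
have Lsub x y z : star I x -> star I y -> J z -> star I (x * y * z).
  move=> hx hy Jz; apply/(starE h _ iI) => M' mM'; have pM' := star_max_prime h mM'.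
  suff : star I (x * y * z) by move/(starE h _ iI); apply.
  have aux a b : I a -> I b -> star I (a * b * z).
    move=> Ia Ib; rewrite eJ; apply: (star_extensive hS iL).
    by apply: ideal_mul_gen => //; apply: ideal_mul_gen.
  rewrite -mulrA mulrC; apply: (star_colon h iI iI _ hx) => a Ia.
  have -> : y * z * a = a * z * y by ring.
  by apply: (star_colon h iI iI _ hy) => b Ib; rewrite mulrAC; apply: aux.
have JC z : J z -> C z.
  by move=> Jz a ha b hb; rewrite -mulrA mulrC; apply: Lsub.
(* At [M], [a] is a sum of products [p * q * z] with [p], [q] in [I] and [z] in [J]; times [c] these
   regroup as [(p * c) * (q * z)]. *)
have Hidem x : H x -> loc A M (ideal_mul H H) x.
  have aHH : add_closed (loc A M (ideal_mul H H)).
    by apply: loc_add => //; apply: ideal_mul_submodule.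
  apply: (ideal_mul_sub aHH) => a c ha hc.
  have : loc A M (ideal_mul (ideal_mul I I) J) a.
    by move: ha; rewrite eJ => /(starE h _ iL); apply.
  move=> [s [As ns hs]]; apply: (loc_unit hA pM As ns); apply: (sub_loc hA pM).
  have aHH' : add_closed (ideal_mul H H) by apply: submodule_add hA _; apply: ideal_mul_submodule.
  rewrite mulrA; apply: (@ideal_mul_sub _ (ideal_mul I I) J [set w | ideal_mul H H (w * c)]) hs.
    by split=> [/=|p q /= ? ?]; [rewrite mul0r; exact: aHH'.1|rewrite mulrBl; apply: aHH'.2].
  move=> w z hw Jz /=.
  apply: (@ideal_mul_sub _ I I [set w | ideal_mul H H (w * z * c)]) hw.
    by split=> [/=|p q /= ? ?]; [rewrite !mul0r; exact: aHH'.1|rewrite !mulrBl; apply: aHH'.2].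
  move=> p q Ip Iq /=; have -> : p * q * z * c = (p * c) * (q * z) by ring.
  apply: ideal_mul_gen; apply: ideal_mul_gen; [exact: Isub|exact: hc|exact: Isub|exact: JC].
have HD x : H x -> D x by move=> /HE; apply: colon_krull.
have unit_at l : over_max M l -> exists x, [/\ H x, x != 0 & v l x = 0].
  move=> hl; apply: contrapT => hn.
  have pos x : H x -> x != 0 -> 1 <= v l x.
    move=> Hx x0; have := vge_nz x0 (krull_vge l (HD x Hx)).
    case: (eqVneq (v l x) 0) => [vx|]; last by lia.
    by case: hn; exists x.
  have [_ [x1 Hx1 x10] _] := iH.
  have [n] : exists n, `[< exists2 x, H x /\ x != 0 & v l x = n%:Z >].
    by exists `|v l x1|%N; apply/asboolP; exists x1 => //; have := pos x1 Hx1 x10; lia.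
  (* If no smaller value occurs in [H], a product of two elements of [H] has one factor of value at
     least [n] and the other at least 1, so [x], locally in [H^2], cannot have value [n]. *)
  elim/ltn_ind: n => n IH /asboolP[x [Hx x0] vx].
  have [s [As ns hs]] := Hidem x Hx.
  have small : vge (v l) (n.+1%:Z) (s * x).
    apply: (ideal_mul_sub (vge_add (hv l) _)) hs => a b Ha Hb.
    case: (eqVneq a 0) => [->|a0]; first by rewrite mul0r; left.
    case: (eqVneq b 0) => [->|b0]; first by rewrite mulr0; left.
    have va := pos a Ha a0; have vb := pos b Hb b0.
    case: (lerP n%:Z (v l a)) => na.
      by right; case: (hv l) => vM _ _; rewrite vM //; lia.
    by case: (IH `|v l a|%N); [lia|apply/asboolP; exists a => //; lia].
  have s0 := notin_prime_neq0 pM ns.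
  have := vge_nz x0 (vge_cancel (hv l) s0 (hl s As ns) small); rewrite vx; lia.
have [_ [x1 Hx1 x10] _] := iH.
have [y My y0] : exists2 y, M y & y != 0 by case: (star_max_ideal mM).
(* All valuations over [M] are positive on [y], so [s] contains them all. *)
have [s hs] := finite_set_list (fin y0).
have [b [Hb hb]] : exists b : seq K, (forall x, x \in b -> H x) /\
    forall l, l \in s -> over_max M l -> exists x, [/\ x \in b, x != 0 & v l x = 0].
  elim: {hs} s => [|l s [b [Hb hb]]]; first by exists [::].
  case: (pselect (over_max M l)) => hl.
    have [x [Hx x0 vx]] := unit_at l hl; exists (x :: b); split.
      by move=> z; rewrite inE => /orP[/eqP ->|/Hb].
    move=> k; rewrite inE => /orP[/eqP -> _|ks hk].
      by exists x; rewrite inE eqxx.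
    by have [z [zb z0 vz]] := hb k ks hk; exists z; rewrite inE zb orbT.
  exists b; split=> // k; rewrite inE => /orP[/eqP ->//|]; exact: hb.
(* [x1] provides a nonzero generator even if [b] is empty. *)
pose g := x1 :: b.
have [|c [ec hc]] := regular_invertible h hreg mM (a := fun i : 'I_(size g) => tnth (in_tuple g) i).
  by exists ord0.
have Hg i : H (tnth (in_tuple g) i).
  by have := mem_tnth i (in_tuple g); rewrite inE => /orP[/eqP ->|/Hb].
apply: (lying_over h mM sH HM _ _ ec) => [i|j]; first by apply: sub_loc.
apply: (loc_krull_mem mM) => l hl.
have [|x [xb x0 vx]] := hb l _ hl.
  by apply: hs => /=; have := max_val_gt0 mM hl My y0; lia.
have /tnthP[i ei] : x \in in_tuple g by rewrite inE xb orbT.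
apply: (vge_cancel (hv l) x0 vx); apply: (loc_krull_vge mM) hl _.
by rewrite ei.
Qed.

End RegularKrull.

(** * A discrete valuation from a uniformizer *)

Section DiscreteValuationRing.
Variables (K : fieldType) (V : set K) (p : K).
Hypotheses (hV : subring V) (p0 : p != 0) (Vp : V p) (nVp : ~ V p^-1).
Hypothesis gen : forall w, V w -> ~ V w^-1 -> V (w / p).
Hypothesis total : forall w, V w \/ V w^-1.
Hypothesis arch : forall t, t != 0 -> exists n, V (p ^+ n / t).

Let VM x y : V x -> V y -> V (x * y). Proof. by case: hV => _ _; apply. Qed.

Lemma uniformizer_exp (k : int) : V (p ^ k) <-> 0 <= k.
Proof.
case: k => n; split=> //; first by move=> _; apply: subringX.
rewrite NegzE -invr_expz => hp; case: nVp.
have -> : p^-1 = p ^+ n * (p ^ n.+1%:Z)^-1.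
  by rewrite -exprnP exprS; field; rewrite p0 expf_neq0.
by apply: VM => //; apply: subringX.
Qed.

Let unit x := [/\ x != 0, V x & V x^-1].

Lemma order_exists x : x != 0 -> exists k : int, unit (x * p ^ (- k)).
Proof.
have pz k : p ^ k != 0 by apply: expfz_neq0.
have main y : y != 0 -> V y -> exists n : nat, unit (y * p ^ (- n%:Z)).
  (* If every [y / p ^+ n] lay in [V], dividing by [y * p] rather than [y] would leave exactly
     [p^-1]; so there is a last exponent [n], and [gen] makes that quotient a unit. *)
  move=> y0 Vy; have [N hN] := arch (mulf_neq0 y0 p0).
  have [n [hn hn1]] : exists n : nat, V (y * p ^ (- n%:Z)) /\ ~ V (y * p ^ (- n.+1%:Z)).
    apply: contrapT => hno; have all n : V (y * p ^ (- n%:Z)).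
      elim: n => [|n IH]; first by rewrite oppr0 expr0z mulr1.
      by apply: contrapT => hn; apply: hno; exists n.
    case: nVp; have := VM hN (all N); congr V.
    by rewrite -invr_expz -exprnP; field; rewrite y0 p0 expf_neq0.
  exists n; split=> //; first by rewrite mulf_neq0.
  apply: contrapT => hi; apply: hn1; have := gen hn hi; congr V.
  by rewrite -mulrA -{2}(expr1z p) invr_expz -expfzDr //; congr (_ * p ^ _); lia.
move=> x0; case: (total x) => Vx; first by have [n hn] := main x x0 Vx; exists n.
have xi0 : x^-1 != 0 by rewrite invr_eq0.
have [n [_ h1 h2]] := main _ xi0 Vx; exists (- n%:Z); split.
- by rewrite mulf_neq0.
- by rewrite opprK; move: h2; rewrite invfM invrK invr_expz opprK.
- by rewrite opprK invfM invr_expz.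
Qed.

Lemma dvr_valuation : exists v, [/\ discrete_valuation v, v 0 = 0
  & forall x, V x <-> vge v 0 x].
Proof.
have pz k : p ^ k != 0 by apply: expfz_neq0.
have /choice[v hv] : forall x, exists k : int, if x == 0 then k = 0 else unit (x * p ^ (- k)).
  by move=> x; case: eqVneq => [_|/order_exists//]; exists 0.
have hv0 : v 0 = 0 by have := hv 0; rewrite eqxx.
have hvn x : x != 0 -> unit (x * p ^ (- v x)) by move=> x0; have := hv x; rewrite (negPf x0).
have vP x j : x != 0 -> V (x * p ^ (- j)) <-> j <= v x.
  move=> x0; have [u0 u1 u2] := hvn x x0; split=> hj.
    rewrite -subr_ge0 -uniformizer_exp; have := VM u2 hj; congr V.
    rewrite expfzDr // -!invr_expz; field.
    by rewrite !pz x0.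
  move: hj; rewrite -subr_ge0 -uniformizer_exp => hj; have := VM u1 hj; congr V.
  by rewrite -mulrA -expfzDr //; congr (_ * p ^ _); ring.
exists v; split=> // [|x].
  split.
  - move=> x y x0 y0; have xy0 := mulf_neq0 x0 y0; apply/eqP; rewrite eq_le; apply/andP; split.
      have [_ u1 _] := hvn _ xy0; have [_ _ u2] := hvn _ x0.
      rewrite addrC -lerBlDr -(vP y) //; have := VM u1 u2; congr V.
      by rewrite opprB expfzDr // -!invr_expz; field; rewrite !pz x0.
    rewrite -vP //; have [_ u1 _] := hvn _ x0; have [_ u2 _] := hvn _ y0.
    have := VM u1 u2; congr V.
    by rewrite opprD expfzDr // mulrACA.
  - move=> x y x0 y0 xy0; rewrite -vP // mulrDl.
    apply: add_closedD; first exact: subring_add.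
      by rewrite vP // ge_min lexx.
    by rewrite vP // ge_min lexx orbT.
  - move=> n; exists (p ^ n) => //.
    have [_ u1 u2] := hvn _ (pz n); move: u1 u2; rewrite -expfzDr // invr_expz !uniformizer_exp.
    lia.
case: (eqVneq x 0) => [->|x0].
  by split=> _; [left|exact: (subring_add hV).1].
have := vP x 0 x0; rewrite oppr0 expr0z mulr1 => ->.
by split=> [|/vge_nz]; [right|apply].
Qed.

End DiscreteValuationRing.

(** * Stability in dimension one: isolation, finiteness, quadratic closure *)

Section Stable.
Variables (K : fieldType) (A : set K) (star : set K -> set K).
Hypotheses (h : spectral_setting A star) (hst : star_stable A star)
  (hdim : star_dimension_one A star).
Local Notation D := (intclosure A star).
Implicit Types I J H M : set K.

Let hA : subring A := setting_ring h.
Let hK := setting_frac h.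
Let hS := setting_star h.
Let A1 : A 1. Proof. by case: hA. Qed.
Let AM x y : A x -> A y -> A (x * y). Proof. by case: hA => _ _; apply. Qed.

Lemma star_max_minimal M : star_max A star M -> minimal_prime A M.
Proof.
move=> mM; apply: (height_one_minimal hA (star_max_prime h mM)); apply: hdim; split.
  by split; [exact: star_max_ideal mM|exact: (star_max_prime h)].
by case: mM => -[].
Qed.

Lemma star_max_arch M y t : star_max A star M -> M y -> t != 0 ->
  exists n, loc A M A (y ^+ n / t).
Proof.
move=> mM; apply: (height_one_arch hA hK (star_max_prime h mM)).
exact: star_max_minimal.
Qed.

Lemma stable_partition I M : ideal A I -> star_max A star M ->
  exists s n (a c : 'I_n -> K), [/\ A s, ~ M s, s = \sum_i a i * c i,
    forall i, I (a i) & forall i, colon (colon (star I) (star I)) (star I) (c i)].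
Proof.
move=> iI mM; have isI := star_ideal_closed hS iI.
have iE := star_colon_ideal h iI; have iC := colon_ideal hA hK isI iE.
have : star (ideal_mul (star I) (colon (colon (star I) (star I)) (star I))) 1.
  by rewrite hst // => y; rewrite mul1r.
move/(starE h _ (ideal_mul_ideal hA isI iC))/(_ M mM).
case/(loc_mul_star h iI iC mM) => s [As ns [n [a [c [Ia Cc e]]]]].
by exists s, n, a, c; rewrite mulr1 in e.
Qed.

(* [xR_M \cap R] is divisorial with trivial endomorphism ring and extends to
   [R_N] at every other [N]; being stable it is finitely generated up to
   star, and so is carried into [xR] by some [s] outside [M]. *)
Lemma star_max_isolated x M : A x -> x != 0 -> star_max A star M -> M x ->
  exists s, [/\ A s, ~ M s & forall N, star_max A star N -> N x -> N <> M -> N s].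
Proof.
move=> Ax x0 mM Mx; have pM := star_max_prime h mM.
have [lA0 lAB] := loc_add hA pM (ring_submodule hA).
have lAM : forall a b, loc A M A a -> loc A M A b -> loc A M A (a * b).
  by move=> a b; apply: (locM hA pM).
pose I := [set r | A r /\ loc A M A (r / x)].
have iI : ideal A I.
  split.
  - split; first by split; [exact: (subring_add hA).1|rewrite mul0r].
    + move=> a b [Aa la] [Ab lb]; split; first by apply: add_closedD => //; exact: subring_add.
      by rewrite mulrDl; apply: add_closedD.
    + move=> a b Aa [Ab lb]; split; first exact: AM.
      by rewrite -mulrA; apply: lAM => //; apply: sub_loc.
  - by exists x => //; split=> //; rewrite divff //; apply: sub_loc.
  - by exists 1; split=> //; [exact: oner_neq0|move=> y []; rewrite mul1r].
(* For [z] in [M] outside [N], a power of [z] is divisible by [x] at [M], hence lies in [I]. *)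
have off N : star_max A star N -> N <> M -> exists2 y, I y & ~ N y.
  move=> mN NM; have pN := star_max_prime h mN.
  have [z Mz nz] : exists2 z, M z & ~ N z.
    apply: contrapT => hn; apply: NM.
    case: mM => _; apply; first by case: mN.
    by move=> z Mz; apply: contrapT => nz; apply: hn; exists z.
  have [n ln] := star_max_arch mM Mz x0.
  have Az : A z by case: pM => _ MA _ _; apply: MA.
  by exists (z ^+ n); [split=> //; exact: subringX|apply: (primeX hA pN)].
have in_base u : (forall N, star_max A star N -> loc A N A u) -> A u.
  by move=> hu; rewrite -(star_ring hS); apply/(starE h _ (ring_ideal hA)).
have sI : star I = I.
  rewrite predeqE => r; split; last exact: star_extensive hS _ iI r.
  move=> /(starE h _ iI) hr; split.
    by apply: in_base => N mN; apply: loc_mono (hr N mN) => ? [].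
  have [s [As ns [_]]] := hr M mM; rewrite -mulrA.
  exact: (loc_unit hA pM).
(* At [M] the multiplier is tested on [x], at another [N] on an element of [I] outside [N]. *)
have colonA u : colon I I u -> A u.
  move=> hu; apply: in_base => N mN; case: (pselect (N = M)) => [->|NM].
    have [|_] := hu x; last by rewrite mulfK.
    by split=> //; rewrite divff //; apply: sub_loc.
  have [y Iy ny] := off N mN NM.
  by exists y; split=> //; [case: Iy|rewrite mulrC; case: (hu y Iy)].
have isI := star_ideal_closed hS iI.
have iE := star_colon_ideal h iI; have iC := colon_ideal hA hK isI iE.
set C := colon _ (star I) in iC; set P := ideal_mul (star I) C.
have iP : ideal A P by exact: ideal_mul_ideal.
have P1 : star P 1 by rewrite /P /C hst // => y; rewrite mul1r.
(* One [t] clears the denominators of the [a i / x] at [M], and each [c i] carries [I] into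
   [(I : I)], which is inside [A]. *)
have mult z : exists t, [/\ A t, ~ M t & P z -> forall y, I y -> A (t * z * y / x)].
  case: (pselect (P z)) => [|nP]; last by exists 1; split=> //; [exact: (prime1 pM)].
  move=> [n [a [c [Ia Cc ez]]]].
  have [|t [At nt ht]] := loc_common hA pM (ring_submodule hA) (x := fun i => a i / x).
    by move=> i; have := Ia i; rewrite sI => -[].
  exists t; split=> // _ y Iy.
  have -> : t * z * y / x = \sum_i (t * (a i / x)) * (c i * y).
    rewrite ez mulr_sumr !mulr_suml; apply: eq_bigr => i _; ring.
  apply: (submodule_sum hA (ring_submodule hA)) => // i.
  by apply: colonA; have := Cc i y; rewrite sI; apply.
have /choice[t ht] := mult.
move: P1; rewrite (setting_finite h iP) => -[J [fJ JP] J1].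
have [n [g [hg eJ]]] := fg_idealP fJ.
have [AT nT] := prime_prod hA pM (s := fun i => t (g i)) (fun i => let: And3 a b _ := ht (g i) in conj a b).
set T := \prod_i t (g i) in AT nT.
(* [T] works for all generators of [J]; as [1] is in [star J] and [x A] is closed, it carries [I]
   into [x A]. *)
have TI y : I y -> A (T * y / x).
  move=> Iy.
  have xA0 : star [set x * a | a in A] = [set x * a | a in A].
    by rewrite (star_scale hS x0 (ring_ideal hA)) (star_ring hS).
  suff : star [set x * a | a in A] (T * y * 1).
    by rewrite xA0 mulr1 => -[a Aa <-]; rewrite mulrAC divff // mul1r.
  have ixA := scale_ideal h x0 (ring_ideal hA).
  apply: (star_colon h (proj1 fJ) ixA _ J1) => z; rewrite eJ => -[c Ac ->].
  rewrite xA0 mulr_sumr; under eq_bigr => i _ do rewrite mulrCA.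
  apply: (submodule_sum hA _ Ac) => [|i]; first by case: ixA.
  have [At nt /(_ _ y Iy) hA'] := ht (g i).
  have Pg : P (g i) by apply: JP; rewrite eJ; apply: span_gen.
  exists (T * y * g i / x); last by rewrite mulrC divfK.
  rewrite /T (bigD1 i) //=; set Q := \prod_(j | _) _.
  have AQ : A Q.
    by apply: (big_ind A) => // j _; case: (ht (g j)).
  have -> : t (g i) * Q * y * g i / x = Q * (t (g i) * g i * y / x) by ring.
  by apply: AM => //; apply: hA'.
exists T; split=> // N mN Nx NM; have [y Iy ny] := off N mN NM.
have pN := star_max_prime h mN.
have [sN _ _ Np] := pN.
case: (Np T y AT (proj1 Iy)) => //.
have -> : T * y = T * y / x * x by rewrite divfK.
by case: sN => _ _; apply => //; apply: TI.
Qed.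

(** [W] collects the elements lying in all but finitely many of the star-maximal ideals containing
    [x]. Isolation makes it escape each of them, so by [star_compact] finitely many exceptional
    lists cover them all. *)
Lemma star_max_finite x : A x -> x != 0 ->
  exists s : seq {classic (set K)}, forall M, star_max A star M -> M x -> M \in s.
Proof.
move=> Ax x0.
pose W := [set r | A r /\ exists s : seq {classic (set K)},
  forall M, star_max A star M -> M x -> M \notin s -> M r].
have iW : ideal A W.
  split.
  - split; first by split; [exact: (subring_add hA).1|exists [::] => M mM _ _; case: (star_max_prime h mM) => -[]].
    + move=> a b [Aa [s hs]] [Ab [r hr]]; split; first by apply: add_closedD => //; exact: subring_add.
      exists (s ++ r) => M mM Mx; rewrite mem_cat negb_or => /andP[ns nr].
      have [[_ MD _] _ _ _] := star_max_prime h mM.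
      by apply: MD; [exact: hs|exact: hr].
    + move=> a b Aa [Ab [s hs]]; split; first exact: AM.
      exists s => M mM Mx ns; have [[_ _ MZ] _ _ _] := star_max_prime h mM.
      by apply: MZ => //; apply: hs.
  - by exists x => //; split=> //; exists [::].
  - by exists 1; split=> //; [exact: oner_neq0|move=> y []; rewrite mul1r].
have [|M mM|n [g [Wg hg]]] := star_compact h iW; first by move=> y [].
  case: (pselect (M x)) => Mx; last by exists x => //; split=> //; exists [::].
  have [s [As ns hs]] := star_max_isolated Ax x0 mM Mx; exists s => //; split=> //.
  exists [:: (M : {classic (set K)})] => N mN Nx; rewrite inE => /eqP NM; exact: hs.
have /choice[s hs] : forall i, exists s : seq {classic (set K)},
    forall M, star_max A star M -> M x -> M \notin s -> M (g i).
  by move=> i; case: (Wg i).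
exists (flatten [seq s i | i <- enum 'I_n]) => M mM Mx.
have [i ni] := hg M mM; apply/flatten_mapP; exists i; first by rewrite mem_enum.
by apply: contrapT => /negP nsi; apply: ni; apply: hs.
Qed.

Section AtM.
Variable M : set K.
Hypothesis mM : star_max A star M.
Let pM := star_max_prime h mM.
Local Notation AM_ := (loc A M A).
Local Notation B := (loc A M D).

Lemma loc_sub_intclosure : AM_ `<=` B.
Proof. by apply: loc_mono; apply: sub_intclosure. Qed.

(* The fractional ideal [I = (1, x, y)] is a ring at [M]: [(E : I)] lies in [E]
   as [1 \in I], and extends to the unit ideal of [D_M]; lying over then puts
   [1] in [(E : I)], i.e. [I] in [E]. *)
Lemma quadratic x y : B x -> B y -> exists r p q,
  [/\ AM_ r, AM_ p, AM_ q & x * y = r + p * x + q * y].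
Proof.
move=> Bx By.
have main a b : D a -> D b -> exists r p q,
    [/\ AM_ r, AM_ p, AM_ q & a * b = r + p * a + q * b].
  move=> Da Db.
  pose g (i : 'I_3) := if i == ord0 then 1 else if i == ord_max then b else a.
  have hg : exists i, g i != 0 by exists ord0; exact: oner_neq0.
  set I := span A g; have iI : ideal A I := span_ideal hA hK hg.
  have Ig := span_gen hA g.
  have I1 : I 1 := Ig ord0.
  have Ia : I a := Ig (lift ord0 ord0).
  have Ib : I b := Ig ord_max.
  have Isub := star_extensive hS iI.
  have sI := star_submodule h iI.
  have ED : colon (star I) (star I) `<=` D.
    by move=> u hu; exists I => //; apply: span_fg_ideal.
  have ID : I `<=` D.
    apply: (span_sub hA (intclosure_submodule h)).
    move=> i; rewrite /g; case: ifP => _; first by case: (intclosure_subring h).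
    by case: ifP.
  have [s [n [u [c [As ns es Iu hc]]]]] := stable_partition iI mM.
  set C := colon _ (star I) in hc.
  have CE z : C z -> colon (star I) (star I) z.
    by move=> Cz; rewrite -[z]mulr1; apply: Cz; apply: Isub.
  have sC : submodule A C by apply: colon_submodule; apply: colon_submodule.
  have CM z w : C z -> C w -> C (z * w).
    by move=> Cz Cw e Ie; rewrite -mulrA => f If; rewrite -mulrA; apply: (CE _ Cz); apply: (Cw e Ie).
  have s0 := notin_prime_neq0 pM ns.
  have [t [At nt]] : loc A M C 1.
    apply: (@lying_over _ _ _ h M C n c (fun i => u i / s)) => //.
    - by move=> i; apply: sub_loc.
    - move=> i; exists s; split=> //; rewrite mulrC divfK //; exact: ID.
    - under eq_bigr => i _ do rewrite mulrA [c i * _]mulrC.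
      by rewrite -mulr_suml -es divff.
  rewrite mulr1 => Ct.
  have : loc A M I (a * b).
    apply: (loc_unit hA pM At nt); rewrite mulrA.
    have : star I (t * a * b) by apply: Ct; apply: Isub.
    by move/(starE h _ iI); apply.
  move/(loc_span h mM) => [N hN ->].
  exists (N ord0), (N (lift ord0 ord0)), (N ord_max); split=> //.
  rewrite !big_ord_recl big_ord0 /g /= mulr1 addr0 addrA.
  congr (_ + N _ * _ + N _ * _); exact: val_inj.
move: Bx By => [s [As ns Ds]] [t [At nt Dt]].
have [r [p [q [lr lp lq e]]]] := main _ _ Ds Dt.
have s0 := notin_prime_neq0 pM ns; have t0 := notin_prime_neq0 pM nt.
have lM a b : AM_ a -> AM_ b -> AM_ (a * b) by apply: (locM hA pM).
have ls := loc_inv hA pM As ns; have lt := loc_inv hA pM At nt.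
exists (s^-1 * t^-1 * r), (t^-1 * p), (s^-1 * q); split.
- by apply: (lM _ _ _ lr); apply: lM.
- exact: lM.
- exact: lM.
have -> : x * y = s^-1 * t^-1 * (s * x * (t * y)) by field; rewrite s0 t0.
by rewrite e; field; rewrite s0 t0.
Qed.

End AtM.
End Stable.

(** * Localizations of the closure are discrete valuation rings *)

Section LocalValuation.
Variables (K : fieldType) (A : set K) (star : set K -> set K).
Hypotheses (h : spectral_setting A star) (hst : star_stable A star)
  (hdim : star_dimension_one A star).
Local Notation D := (intclosure A star).
Variable M : set K.
Hypothesis mM : star_max A star M.
Local Notation B := (loc A M D).
Variable N : set K.
Hypotheses (hN : spec_prime B N) (nK : exists u, ~ loc B N B u).
Local Notation V := (loc B N B).

Let hA : subring A := setting_ring h.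
Let hreg := stable_regular h hst.
Let pM := star_max_prime h mM.
Let hB : subring B.
Proof. exact: (loc_subring hA pM (intclosure_subring h) (@sub_intclosure _ _ _ h)). Qed.
Let hV : subring V. Proof. exact: (loc_subring hB hN hB). Qed.
Let BV : B `<=` V. Proof. exact: sub_loc. Qed.
Let BM x y : B x -> B y -> B (x * y). Proof. by case: hB => _ _; apply. Qed.
Let VM x y : V x -> V y -> V (x * y). Proof. by case: hV => _ _; apply. Qed.
Let AB : loc A M A `<=` B. Proof. exact: loc_sub_intclosure h M. Qed.
Let MA : M `<=` A. Proof. by case: pM. Qed.
Let MB : M `<=` B. Proof. by move=> m /MA Am; apply/AB/sub_loc. Qed.
Let NB : N `<=` B. Proof. by case: hN. Qed.
Let sN : submodule B N. Proof. by case: hN. Qed.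
Let aN : add_closed N. Proof. exact: submodule_add sN. Qed.
Let NM x y : B x -> N y -> N (x * y). Proof. by case: sN => _ _; apply. Qed.

(** In [c + w * d = 1] one term is outside [N]: [c] is then a denominator for [w], or [w * d] one
    for [w^-1]. *)
Lemma local_total w : V w \/ V w^-1.
Proof.
have [|c [d [e hc hd hwc hwd]]] := @regular_pair _ _ _ h hreg M mM 1 w.
  by rewrite oner_neq0.
rewrite mul1r in hc; rewrite mul1r in hd; rewrite mul1r in e.
case: (pselect (N c)) => Nc; last by left; exists c; split=> //; rewrite mulrC.
right; case: (eqVneq w 0) => [->|w0]; first by rewrite invr0; exact: (subring_add hV).1.
exists (w * d); split=> //; last by rewrite mulrAC divff // mul1r.
by move=> Nwd; apply: (prime1 hN); rewrite -e; apply: add_closedD.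
Qed.

Lemma local_nonunit w : V w -> ~ V w^-1 ->
  exists b s, [/\ N b, B s, ~ N s & w = b / s].
Proof.
move=> [s [Bs ns hs]] nV; have s0 := notin_prime_neq0 hN ns.
exists (s * w), s; split=> //; last by rewrite mulrC mulKf.
apply: contrapT => nsw; apply: nV; exists (s * w); split=> //.
have w0 := notin_prime_neq0 hN nsw.
rewrite mulfK //; apply/eqP => e; apply: nsw; rewrite e mulr0; exact: aN.1.
Qed.

Lemma local_inv s : B s -> ~ N s -> V s^-1.
Proof. exact: loc_inv. Qed.

Lemma max_unit s : A s -> ~ M s -> B s^-1 /\ ~ N s.
Proof.
move=> As ns; have Bi : B s^-1 by apply: AB; apply: loc_inv.
split=> // Ns; apply: (prime1 hN); rewrite -(mulVf (notin_prime_neq0 pM ns)).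
exact: NM.
Qed.

Lemma prime_contract r : loc A M A r -> N r -> loc A M M r.
Proof.
move=> [s [As ns hs]] Nr; exists s; split=> //.
apply: contrapT => nsr; have [_] := max_unit hs nsr; apply.
by apply: NM => //; apply/AB/sub_loc.
Qed.

(** Here [b ^+ 2 = r + q * b]. If [q] is outside [N], then [b - q] is a unit of [V] and
    [r = b * (b - q)] serves up to a unit; otherwise so does whichever of [r], [q] divides the other
    in [V]. *)
Lemma prime_square b : N b -> exists m, [/\ M m, m != 0 & V (b ^+ 2 / m)].
Proof.
move=> Nb; have Bb := NB Nb.
have [m0 Mm0 m00] : exists2 y, M y & y != 0 by case: (star_max_ideal mM).
case: (eqVneq b 0) => [->|b0].
  by exists m0; split=> //; rewrite expr0n mul0r; exact: (subring_add hV).1.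
have [r [p' [q' [lr lp lq e]]]] := quadratic h hst mM Bb Bb.
set q := p' + q'; have {}lq : loc A M A q.
  by apply: add_closedD => //; apply: loc_add => //; apply: ring_submodule.
have {}e : b ^+ 2 = r + q * b by rewrite expr2 e /q; ring.
have Nr : N r.
  have -> : r = b * b - q * b by rewrite -expr2 e; ring.
  by apply: aN.2; apply: NM => //; apply: AB.
have [s1 [As1 ns1 M1]] := prime_contract lr Nr.
have [Bi1 nN1] := max_unit As1 ns1; have s10 := notin_prime_neq0 pM ns1.
case: (pselect (N q)) => Nq; last first.
  have nbq : ~ N (b - q).
    by move=> Nbq; apply: Nq; rewrite -(subKr b q); apply: aN.2.
  have bq0 := notin_prime_neq0 hN nbq.
  have er : r = b * (b - q) by rewrite mulrBr -expr2 e; ring.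
  have r0 : r != 0 by rewrite er mulf_neq0.
  exists (s1 * r); split=> //; first by rewrite mulf_neq0.
  have -> : b ^+ 2 / (s1 * r) = b * s1^-1 * (b - q)^-1 by rewrite er; field; rewrite s10 bq0 b0.
  apply: VM; first by apply: BV; apply: BM.
  by apply: local_inv => //; apply: (subring_add hB).2 => //; apply: AB.
have [s2 [As2 ns2 M2]] := prime_contract lq Nq.
have [Bi2 nN2] := max_unit As2 ns2; have s20 := notin_prime_neq0 pM ns2.
have [m [Mm m_0 V1 V2]] : exists m, [/\ M m, m != 0, V (s1 * r / m) & V (s2 * q / m)].
  have [V0 _] := subring_add hV.
  have V1 : V 1 by case: hV.
  case: (eqVneq (s1 * r) 0) => [->|n1].
    case: (eqVneq (s2 * q) 0) => [->|n2]; first by exists m0; rewrite !mul0r.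
    by exists (s2 * q); rewrite mul0r divff.
  case: (local_total (s2 * q / (s1 * r))) => hv; first by exists (s1 * r); rewrite divff.
  case: (eqVneq (s2 * q) 0) => [e2|n2]; first by exists (s1 * r); rewrite e2 mul0r divff.
  by exists (s2 * q); rewrite divff //; rewrite invf_div in hv.
exists m; split=> //.
have -> : b ^+ 2 / m = s1^-1 * (s1 * r / m) + s2^-1 * b * (s2 * q / m).
  by rewrite e; field; rewrite m_0 s10 s20.
apply: add_closedD; first exact: subring_add.
  by apply: VM => //; apply: BV.
by apply: VM => //; apply: BV; apply: BM.
Qed.

Lemma local_arch w t : V w -> ~ V w^-1 -> t != 0 -> exists n, V (w ^+ n / t).
Proof.
move=> Vw nw t0; have [b [s [Nb Bs ns ->]]] := local_nonunit Vw nw.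
have [m [Mm m0 Vm]] := prime_square Nb.
have [n ln] := star_max_arch h hdim mM Mm t0.
have s0 := notin_prime_neq0 hN ns.
exists (2 * n)%N.
have -> : (b / s) ^+ (2 * n) / t = (s^-1) ^+ (2 * n) * (b ^+ 2 / m) ^+ n * (m ^+ n / t).
  have e : (b / s) ^+ 2 = s^-1 ^+ 2 * (b ^+ 2 / m) * m by field; rewrite s0 m0.
  by rewrite !exprM e [_ ^+ n]exprMn [(s^-1 ^+ 2 * _) ^+ n]exprMn !mulrA.
apply: VM; last by apply/BV/AB.
by apply: VM; apply: subringX => //; apply: local_inv.
Qed.

(** If [u] were outside [V], [d / u] would divide some [u^-1 ^+ n]; multiplying the quotient by
    [d * u ^+ n] leaves [u]. *)
Lemma local_complete d u : d != 0 -> (forall n, V (d * u ^+ n)) -> V u.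
Proof.
move=> d0 hu; apply: contrapT => nu.
have u0 : u != 0 by apply/eqP => e; apply: nu; rewrite e; exact: (subring_add hV).1.
case: (local_total u) => // Vi.
have ni : ~ V u^-1^-1 by rewrite invrK.
have [n hn] := local_arch Vi ni (mulf_neq0 d0 (invr_neq0 u0)).
apply: nu; have := VM hn (hu n); congr V.
by rewrite exprVn; field; rewrite u0 d0 expf_neq0.
Qed.

(** By [local_complete], [(M : M)] lies in [V], so the [a i * c i] do too. They sum to a unit, hence
    one is a unit, and its [a i] divides all of [M]. *)
Lemma max_generator : exists m, [/\ M m, m != 0 & forall y, M y -> V (y / m)].
Proof.
have iM := star_max_ideal mM; have eM : star M = M by case: mM => -[[]].
have [s [n [a [c [As ns es Ma]]]]] := stable_partition h hst iM mM.
rewrite eM => hc.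
have EV : colon M M `<=` V.
  move=> u hu; have [_ [x Mx x0] _] := iM.
  apply: (@local_complete x u x0) => k; apply/BV/MB.
  elim: k => [|k IH]; first by rewrite mulr1.
  by rewrite exprS mulrCA; apply: hu.
have VN : submodule B (loc B N N) by exact: loc_submodule.
have Vac i y : M y -> V (c i * y) by move=> My; apply/EV/hc.
have [i hi] : exists i, ~ loc B N N (a i * c i).
  apply: contrapT => /forallNP hn; have [_ nNs] := max_unit As ns.
  have Bs : B s by apply/AB/sub_loc.
  apply: nNs; apply: (loc_prime hN _ Bs); first exact: subset_refl.
  rewrite es; apply: add_closed_sum; first exact: loc_add.
  by move=> i _; exact: (contrapT (hn i)).
have ac0 : a i * c i != 0.
  by apply/eqP => e; apply: hi; rewrite e; case: VN.
have [a0 c0] : a i != 0 /\ c i != 0 by move: ac0; rewrite mulf_eq0 negb_or => /andP[].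
exists (a i); split=> // y My.
have -> : y / a i = c i * y * (a i * c i)^-1 by field; rewrite c0 a0.
apply: VM; first exact: Vac.
apply: contrapT => nV; apply: hi.
have Vaci : V (a i * c i) by rewrite mulrC; apply: Vac.
have [b [t [Nb Bt nt e]]] := local_nonunit Vaci nV.
by exists t; split=> //; rewrite e mulrC divfK // (notin_prime_neq0 hN nt).
Qed.

(* If no non-unit generates, each non-unit [z] is divisible by the square of
   another one; two such steps from the generator [m] of [M V] give [z'] with
   [z'^4] dividing [m], whereas [m] divides [z'^2]. *)
Lemma local_uniformizer : exists p, [/\ p != 0, V p, ~ V p^-1
  & forall w, V w -> ~ V w^-1 -> V (w / p)].
Proof.
have [m [Mm m0 hm]] := max_generator.
have nz w : ~ V w^-1 -> w != 0.
  by move=> nw; apply/eqP => e; apply: nw; rewrite e invr0; exact: (subring_add hV).1.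
have Vm : V m by apply/BV/MB.
have nVm : ~ V m^-1.
  have [u nu] := nK => Vi; apply: nu.
  have [->|u0] := eqVneq u 0; first exact: (subring_add hV).1.
  have [n ln] := star_max_arch h hdim mM Mm (invr_neq0 u0).
  have := VM (subringX n hV Vi) (BV (AB ln)); congr V.
  by rewrite exprVn invrK; field; rewrite ?expf_neq0.
have sq w : V w -> ~ V w^-1 -> V (w ^+ 2 / m).
  move=> Vw nw; have [b [s [Nb Bs ns ->]]] := local_nonunit Vw nw.
  have [m' [Mm' m'0 Vm']] := prime_square Nb; have s0 := notin_prime_neq0 hN ns.
  have -> : (b / s) ^+ 2 / m = s^-1 * s^-1 * (b ^+ 2 / m') * (m' / m) by field; rewrite m0 s0 m'0.
  apply: VM; last exact: hm.
  by apply: VM => //; apply: VM; apply: local_inv.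
apply: contrapT => hno.
(* If [z] does not divide the nonunit [z1], it is the product of the nonunits [z1] and [z / z1];
   whichever of them divides the other has its square dividing [z]. *)
have step z : V z -> ~ V z^-1 -> exists z', [/\ V z', ~ V z'^-1 & V (z / z' ^+ 2)].
  move=> Vz nzV; have z0 := nz z nzV.
  have [z1 [Vz1 nz1 nd]] : exists z1, [/\ V z1, ~ V z1^-1 & ~ V (z1 / z)].
    apply: contrapT => hn; apply: hno; exists z; split=> // w Vw nw.
    by apply: contrapT => nwz; apply: hn; exists w.
  have z10 := nz _ nz1.
  have Vq : V (z / z1) by case: (local_total (z1 / z)) => //; rewrite invf_div.
  have nq : ~ V (z / z1)^-1 by rewrite invf_div.
  case: (local_total (z / z1 / z1)) => hq.
    by exists z1; split=> //; rewrite expr2 invfM mulrA.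
  exists (z / z1); split=> //; move: hq; congr V.
  by field; rewrite z0 z10.
have [z [Vz nzV hz]] := step m Vm nVm.
have [w [Vw nw hw]] := step z Vz nzV.
have w0 := nz w nw; have z0 := nz z nzV.
apply: (nw); have := VM Vw (VM (VM hz (VM hw hw)) (sq w Vw nw)); congr V.
by field; rewrite w0 z0 m0.
Qed.

Lemma local_valuation : exists v, [/\ discrete_valuation v, v 0 = 0
  & forall x, V x <-> vge v 0 x].
Proof.
have [p [p0 Vp nVp gen]] := local_uniformizer.
by apply: (dvr_valuation hV p0 Vp nVp gen local_total) => t; apply: local_arch.
Qed.

End LocalValuation.

(** * The Krull family of the closure *)

Section StableKrull.
Variables (K : fieldType) (A : set K) (star : set K -> set K).
Hypotheses (h : spectral_setting A star) (hst : star_stable A star)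
  (hdim : star_dimension_one A star).
Local Notation D := (intclosure A star).

Let hA : subring A := setting_ring h.
Let hK := setting_frac h.
Let hreg := stable_regular h hst.

(** With the value at zero fixed, distinct functions have distinct valuation rings, which the
    counting of valuations uses. *)
Definition local_val (M : set K) (v : K -> int) : Prop :=
  [/\ discrete_valuation v, v 0 = 0 & forall x, loc A M D x -> vge v 0 x].

Lemma exists_valuation M u : star_max A star M -> ~ loc A M D u ->
  exists2 v, local_val M v & ~ vge v 0 u.
Proof.
move=> mM nu; have pM := star_max_prime h mM.
have hB : subring (loc A M D).
  exact: (loc_subring hA pM (intclosure_subring h) (@sub_intclosure _ _ _ h)).
have B1 : loc A M D 1 by case: hB.
have BM x y : loc A M D x -> loc A M D y -> loc A M D (x * y) by case: hB => _ _; apply.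
(* The conductor of [u] is proper; localizing at a prime above it still omits [u]. *)
pose C := [set b | loc A M D b /\ loc A M D (b * u)].
have [|b []//|//|x y -> ->||Q [hQ CQ _]] := @prime_avoiding K (loc A M D) [set 1] C hB.
- split.
  + by split; [exact: (subring_add hB).1|rewrite mul0r; exact: (subring_add hB).1].
  + move=> x y [Bx Bxu] [By Byu]; split; first by apply: add_closedD => //; exact: subring_add.
    by rewrite mulrDl; apply: add_closedD => //; exact: subring_add.
  + by move=> a x Ba [Bx Bxu]; split; [exact: BM|rewrite -mulrA; apply: BM].
- by rewrite /= mulr1.
- by move=> x -> [_]; rewrite mul1r.
have nV : ~ loc (loc A M D) Q (loc A M D) u.
  by move=> [s [Bs ns Bsu]]; apply: ns; apply: CQ.
have [v [dv v0 hv]] := local_valuation h hst hdim mM hQ (ex_intro _ u nV).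
exists v; last by move/hv.
by split=> // x Bx; apply/hv; apply: sub_loc.
Qed.

Lemma valXz (v : K -> int) x (n : int) : discrete_valuation v -> x != 0 -> v (x ^ n) = v x * n.
Proof.
move=> dv x0; case: n => n; first by rewrite -exprnP (valX dv).
by rewrite NegzE -invr_expz (valV dv) ?expfz_neq0 // -exprnP (valX dv) // mulrN.
Qed.

(** Units for [v] are units for [w], so [w] is [w p] times [v]; surjectivity of [w] forces
    [w p = 1]. *)
Lemma valuation_sub_eq (v w : K -> int) : discrete_valuation v -> discrete_valuation w ->
  v 0 = 0 -> w 0 = 0 -> (forall x, vge v 0 x -> vge w 0 x) -> v = w.
Proof.
move=> dv dw v0 w0 vw; have [vM _ /(_ 1)[p p0 vp]] := dv; have [wM _ hw] := dw.
have unit x : x != 0 -> v x = 0 -> w x = 0.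
  move=> x0 vx; have xi0 : x^-1 != 0 by rewrite invr_eq0.
  have h1 : vge w 0 x by apply: vw; right; rewrite vx.
  have h2 : vge w 0 x^-1 by apply: vw; right; rewrite (valV dv) // vx.
  have := vge_nz x0 h1; have := vge_nz xi0 h2; rewrite (valV dw) //; lia.
have wE x : x != 0 -> w x = v x * w p.
  move=> x0; have pz : p ^ (- v x) != 0 by rewrite expfz_neq0.
  have vz : v (x * p ^ (- v x)) = 0 by rewrite vM // valXz // vp mul1r subrr.
  have := unit _ (mulf_neq0 x0 pz) vz; rewrite wM // valXz // mulrN mulrC.
  by move/eqP; rewrite subr_eq0 => /eqP.
have wp : 0 <= w p by apply: (vge_nz p0); apply: vw; right; rewrite vp.
have [q q0 wq] := hw 1.
have wp1 : w p = 1 by move: wq wp; rewrite wE //; case: (lerP (v q) 0); nia.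
by apply: funext => x; case: (eqVneq x 0) => [->|/wE ->]; rewrite ?v0 ?w0 // wp1 mulr1.
Qed.

Section AtM.
Variable M : set K.
Hypothesis mM : star_max A star M.
Let pM := star_max_prime h mM.

(** All valuations over [M] thus have the same trace on the localized base ring. Positivity on [M]
    holds because a power is divisible by an element of value 1. *)
Lemma local_val_base v r : local_val M v -> loc A M A r ->
  vge v 0 r /\ (loc A M M r <-> vge v 1 r).
Proof.
move=> [dv v0 vB] lr.
have AV x : loc A M A x -> vge v 0 x by move=> lx; apply/vB/(loc_sub_intclosure h).
have unit s : A s -> ~ M s -> s != 0 /\ v s = 0.
  move=> As ns; have s0 := notin_prime_neq0 pM ns; split=> //.
  have := vge_nz s0 (AV _ (sub_loc hA pM As)).
  have si0 : s^-1 != 0 by rewrite invr_eq0.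
  have := vge_nz si0 (AV _ (loc_inv hA pM As ns)).
  by rewrite (valV dv) //; lia.
have [s [As ns Asr]] := lr; have [s0 vs] := unit s As ns.
split; first exact: AV.
split=> [[s' [As' ns' Msr]]|vr].
  have [s'0 vs'] := unit s' As' ns'.
  apply: (vge_cancel dv s'0 vs').
  case: (eqVneq (s' * r) 0) => [->|y0]; [by left|right].
  have [vM _ /(_ 1)[t t0 vt]] := dv.
  have [n ln] := star_max_arch h hdim mM Msr t0.
  have yn0 := expf_neq0 n y0.
  have yt0 : (s' * r) ^+ n / t != 0 by rewrite mulf_neq0 ?invr_eq0.
  have := vge_nz yt0 (AV _ ln).
  rewrite vM ?invr_eq0 // (valV dv) // (valX dv) // vt.
  have : A (s' * r) by case: pM => _ + _ _; apply.
  move/(sub_loc hA pM)/AV/(vge_nz y0); nia.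
exists s; split=> //; apply: contrapT => nsr.
have [sr0 vsr] := unit _ Asr nsr.
have : vge v (0 + 1) (s * r) by apply: (vgeM dv) => //; right; rewrite vs.
by move/(vge_nz sr0); rewrite vsr.
Qed.

(** [u] is positive at [v] and negative at [w], so in [c + u * d = 1] the second term is positive at
    [v], and [c = u^-1 * (u * c)] at [w]. *)
Lemma local_val_separate v w : local_val M v -> local_val M w -> v <> w ->
  exists c, [/\ loc A M D c, vge v 1 (1 - c) & vge w 1 c].
Proof.
move=> [dv v0 vB] [dw w0 wB] vw.
have [x [vx nwx]] : exists x, vge v 0 x /\ ~ vge w 0 x.
  apply: contrapT => hn; apply: vw; apply: valuation_sub_eq => // x vx.
  by apply: contrapT => nx; apply: hn; exists x.
have [y [wy nvy]] : exists y, vge w 0 y /\ ~ vge v 0 y.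
  apply: contrapT => hn; apply: vw; apply/esym; apply: valuation_sub_eq => // y wy.
  by apply: contrapT => ny; apply: hn; exists y.
have x0 : x != 0 by apply/eqP => e; apply: nwx; left.
have y0 : y != 0 by apply/eqP => e; apply: nvy; left.
have {}nwx : w x < 0 by rewrite ltNge; apply/negP => ?; apply: nwx; right.
have {}nvy : v y < 0 by rewrite ltNge; apply/negP => ?; apply: nvy; right.
have {}vx := vge_nz x0 vx; have {}wy := vge_nz y0 wy.
have [vM _ _] := dv; have [wM _ _] := dw.
pose u := x / y; have u0 : u != 0 by rewrite mulf_neq0 ?invr_eq0.
have vu : vge v 1 u by right; rewrite vM ?invr_eq0 // (valV dv) //; lia.
have wu : vge w 1 u^-1 by right; rewrite (valV dw) // wM ?invr_eq0 // (valV dw) //; lia.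
have [|c [d [e lc ld luc lud]]] := @regular_pair _ _ _ h hreg M mM 1 u.
  by rewrite oner_neq0.
rewrite mul1r in lc; rewrite mul1r in ld; rewrite mul1r in e.
exists c; split=> //.
  by rewrite -e addrC addKr; apply: (vge1M dv) => //; apply: vB.
have -> : c = u^-1 * (u * c) by rewrite mulKf.
by apply: (vge1M dw) => //; apply: wB.
Qed.

Lemma local_val_separate3 v w1 w2 w3 : local_val M v -> local_val M w1 ->
  local_val M w2 -> local_val M w3 -> v <> w1 -> v <> w2 -> v <> w3 ->
  exists c, [/\ loc A M D c, vge v 1 (c - 1), vge w1 1 c, vge w2 1 c & vge w3 1 c].
Proof.
move=> hv h1 h2 h3 n1 n2 n3.
have BM x y : loc A M D x -> loc A M D y -> loc A M D (x * y).
  by apply: (locM hA pM); case: (intclosure_subring h).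
have [c1 [l1 v1 w11]] := local_val_separate hv h1 n1.
have [c2 [l2 v2 w22]] := local_val_separate hv h2 n2.
have [c3 [l3 v3 w33]] := local_val_separate hv h3 n3.
have [[dv _ vB] [d1 _ B1] [d2 _ B2] [d3 _ B3]] := And4 hv h1 h2 h3.
have b1 := BM _ _ l1 l2; have b2 := BM _ _ l2 l3; have b3 := BM _ _ l1 l3.
have a1 := vge_add dv 1.
exists (c1 * c2 * c3); split; first exact: BM.
- have -> : c1 * c2 * c3 - 1 = - ((1 - c1) + (1 - c2) * c1 + (1 - c3) * (c1 * c2)) by ring.
  apply: add_closedN => //; do 2?[apply: add_closedD => //]; apply: (vge1M dv) => //; exact: vB.
- by rewrite -mulrA; apply: (vge1M d1) => //; apply: B1.
- by rewrite [c1 * c2]mulrC -mulrA; apply: (vge1M d2) => //; apply: B2.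
- by rewrite mulrC; apply: (vge1M d3) => //; apply: B3.
Qed.

Lemma quadratic_residue (v : K -> int) x y r p q a b : discrete_valuation v ->
  vge v 0 x -> vge v 0 p -> vge v 0 q -> vge v 0 b ->
  vge v 1 (x - a) -> vge v 1 (y - b) -> x * y = r + p * x + q * y ->
  vge v 1 (r + p * a + q * b - a * b).
Proof.
move=> dv vx vp vq vb hx hy e; have a1 := vge_add dv 1.
have -> : r + p * a + q * b - a * b =
    ((y - b) * x + (x - a) * b) - ((x - a) * p + (y - b) * q).
  by rewrite (_ : r = x * y - p * x - q * y); [ring|rewrite e; ring].
by apply: a1.2; apply: add_closedD => //; apply: (vge1M dv).
Qed.

(* Four distinct residue maps would realize the vectors [(1,1,0,0)] and
   [(1,0,1,0)], whose product is not in their span with [(1,1,1,1)]. *)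
Lemma local_val_at_most3 v1 v2 v3 v4 : local_val M v1 -> local_val M v2 ->
  local_val M v3 -> local_val M v4 -> v1 <> v2 -> v1 <> v3 -> v1 <> v4 ->
  v2 <> v3 -> v2 <> v4 -> v3 <> v4 -> False.
Proof.
move=> h1 h2 h3 h4 n12 n13 n14 n23 n24 n34.
have [e1 [b1 p11 p12 p13 p14]] := local_val_separate3 h1 h2 h3 h4 n12 n13 n14.
have [e2 [b2 p22 p21 p23 p24]] :=
  local_val_separate3 h2 h1 h3 h4 (not_eq_sym n12) n23 n24.
have [e3 [b3 p33 p31 p32 p34]] :=
  local_val_separate3 h3 h1 h2 h4 (not_eq_sym n13) (not_eq_sym n23) n34.
have aB := loc_add hA pM (intclosure_submodule h).
have bx := add_closedD aB b1 b2; have by_ := add_closedD aB b1 b3.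
set x := e1 + e2 in bx; set y := e1 + e3 in by_.
have [r [p [q [lr lp lq e]]]] := quadratic h hst mM bx by_.
have [[d1 _ B1] [d2 _ B2] [d3 _ B3] [d4 _ B4]] := And4 h1 h2 h3 h4.
have sA := loc_sub_intclosure h (M := M) : loc A M A `<=` loc A M D.
have aA := loc_add hA pM (ring_submodule hA).
have v01 (v : K -> int) : discrete_valuation v -> vge v 0 1 by move=> dv; right; rewrite val1.
have v00 (v : K -> int) : vge v 0 0 by left.
have aM : add_closed (loc A M M) by apply: loc_add => //; case: pM.
(* By [local_val_base], a residue vanishing at one valuation vanishes at all. So [v4], [v2], [v3]
   give [r], [p], [q] in the localization of [M], while [v1] demands that [r + p + q] have residue
   1. *)
have r0 : loc A M M r.
  apply/(proj2 (local_val_base h4 lr)).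
  have := @quadratic_residue v4 x y r p q 0 0 d4 (B4 _ bx) (B4 _ (sA _ lp)) (B4 _ (sA _ lq)) (v00 _).
  rewrite !mulr0 !addr0 !subr0; apply=> //; apply: add_closedD => //; exact: vge_add.
have p0 : loc A M M p.
  have l : loc A M A (r + p) by exact: add_closedD.
  rewrite -[p](addKr r) addrC; apply: aM.2 => //.
  apply/(proj2 (local_val_base h2 l)).
  have := @quadratic_residue v2 x y r p q 1 0 d2 (B2 _ bx) (B2 _ (sA _ lp)) (B2 _ (sA _ lq)) (v00 _).
  rewrite !mulr0 !addr0 !subr0 mulr1; apply=> //.
    by rewrite /x -addrA; apply: add_closedD => //; exact: vge_add.
  apply: add_closedD => //; exact: vge_add.
have q0 : loc A M M q.
  have l : loc A M A (r + q) by exact: add_closedD.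
  rewrite -[q](addKr r) addrC; apply: aM.2 => //.
  apply/(proj2 (local_val_base h3 l)).
  have := @quadratic_residue v3 x y r p q 0 1 d3 (B3 _ bx) (B3 _ (sA _ lp)) (B3 _ (sA _ lq)) (v01 _ d3).
  rewrite !mulr0 !mul0r !addr0 !subr0 mulr1; apply=> //.
    by apply: add_closedD => //; exact: vge_add.
  by rewrite /y -addrA; apply: add_closedD => //; exact: vge_add.
have s0 : loc A M M (r + p + q) by do 2?[apply: add_closedD => //].
have l : loc A M A (r + p + q) by do 2?[apply: add_closedD => //].
have v1s := proj1 (proj2 (local_val_base h1 l)) s0.
apply: (vge1_not1 d1).
have := @quadratic_residue v1 x y r p q 1 1 d1 (B1 _ bx) (B1 _ (sA _ lp)) (B1 _ (sA _ lq)) (v01 _ d1).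
rewrite !mulr1 => hres.
rewrite -[X in vge _ _ X](subKr (r + p + q)); apply: (vge_add d1 1).2 => //.
apply: hres => //.
  by rewrite /x addrAC; apply: add_closedD => //; exact: vge_add.
by rewrite /y addrAC; apply: add_closedD => //; exact: vge_add.
Qed.

Lemma local_val_finite : exists s : seq {classic (K -> int)},
  forall v, local_val M v -> v \in s.
Proof.
apply: contrapT => hn.
have pick (s : seq {classic (K -> int)}) : exists v,
    local_val M v /\ forall w : {classic (K -> int)}, w \in s -> w <> v.
  apply: contrapT => hno; apply: hn; exists s => v hv.
  apply: contrapT => nv; apply: hno; exists v; split=> // w ws wv.
  by apply: nv; rewrite -wv.
have [v1 [h1 _]] := pick [::].
have [v2 [h2 n2]] := pick [:: v1].
have [v3 [h3 n3]] := pick [:: v1; v2].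
have [v4 [h4 n4]] := pick [:: v1; v2; v3].
by apply: (local_val_at_most3 h1 h2 h3 h4);
  do [apply: n2|apply: n3|apply: n4]; rewrite !in_cons eqxx ?orbT.
Qed.

End AtM.

Lemma stable_dim1_krull : krull_domain D.
Proof.
split.
- exact: intclosure_subring.
- move=> x; have [a [b [Aa Ab b0 ->]]] := hK x.
  by exists a, b; split=> //; apply: (sub_intclosure h).
pose P v := exists2 M, star_max A star M & local_val M v.
exists {v | P v}, (fun l => sval l); split.
- by move=> [v [M mM []]].
- rewrite predeqE => x; split.
    move=> Dx [v [M mM [dv v0 vB]]] _ /=; apply: vB.
    by apply: sub_loc Dx => //; exact: (star_max_prime h).
  move=> hx; apply: (intclosure_loc h) => M mM; apply: contrapT => nx.
  have [v hv nv] := exists_valuation mM nx; apply: nv.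
  by apply: (hx (exist _ v (ex_intro2 _ _ M mM hv)) I).
(* A nonzero value of [a] over [M] puts [a] in [M], since otherwise [a] is a unit there. *)
have finA a : A a -> a != 0 -> exists s : seq {classic (K -> int)},
    forall v, P v -> v a != 0 -> (v : {classic (K -> int)}) \in s.
  move=> Aa a0; have [s hs] := star_max_finite h hst hdim Aa a0.
  have /choice[f hf] : forall M, exists t : seq {classic (K -> int)},
      star_max A star M -> forall v, local_val M v -> (v : {classic (K -> int)}) \in t.
    move=> M; case: (pselect (star_max A star M)) => [mM|nM]; last by exists [::].
    by have [t ht] := local_val_finite mM; exists t.
  exists (flatten [seq f M | M <- s]) => v [M mM hv] va.
  apply/flatten_mapP; exists M; last exact: hf.
  apply: hs => //; apply: contrapT => na; move: va.
  have pM := star_max_prime h mM; have [dv _ _] := hv.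
  have [va _] := local_val_base mM hv (sub_loc hA pM Aa).
  have [vi _] := local_val_base mM hv (loc_inv hA pM Aa na).
  have ai0 : a^-1 != 0 by rewrite invr_eq0.
  have := vge_nz a0 va; have := vge_nz ai0 vi; rewrite (valV dv) //.
  by move=> ? ?; lia.
move=> x x0; have [a [b [Aa Ab b0 ex]]] := hK x.
have a0 : a != 0 by apply: contra x0; rewrite ex => /eqP ->; rewrite mul0r.
have [s hs] := finA a Aa a0; have [t ht] := finA b Ab b0.
have fin : finite_set ([set` s ++ t] : set {classic (K -> int)}) by exact: finite_seq.
apply: (@sub_finite_set _ _ (sval @^-1` [set` s ++ t])).
  move=> [v hv] /= vx; rewrite mem_cat; apply/orP.
  have dv : discrete_valuation v by case: hv => M _ [].
  case: (eqVneq (v a) 0) => [va|va]; last by left; apply: hs.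
  right; apply: ht => //; apply: contra vx => /eqP vb.
  by have [vM _ _] := dv; rewrite ex vM ?invr_eq0 // (valV dv) // va vb.
by apply: finite_preimage fin => -[v1 p1] [v2 p2] _ _ /= e; apply: eq_exist.
Qed.

End StableKrull.

(** * Comparison with [w] and the complete integral closure *)

Section WOperation.
Variables (K : fieldType) (A : set K) (star : set K -> set K).
Hypotheses (h : spectral_setting A star) (hst : star_stable A star)
  (hdim : star_dimension_one A star).
Local Notation D := (intclosure A star).

Let hA : subring A := setting_ring h.
Let hK := setting_frac h.
Let hS := setting_star h.
Let AM x y : A x -> A y -> A (x * y). Proof. by case: hA => _ _; apply. Qed.

Lemma star_sub_v J : ideal A J -> star J `<=` v_op A J.
Proof.
move=> iJ x Jx u hu; rewrite mulrC -(star_ring hS).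
by apply: (star_colon h iJ (ring_ideal hA) _ Jx) => y Jy; rewrite (star_ring hS); apply: hu.
Qed.

Lemma star_sub_t I : ideal A I -> star I `<=` t_op A I.
Proof.
move=> iI x; rewrite (setting_finite h iI) => -[J [fJ JI] Jx].
by exists J => //; apply: star_sub_v Jx; case: fJ.
Qed.

(** By induction, [u] is multiplied by the last power of [x] that keeps it outside the localized
    ring; dimension one ensures there is one. *)
Lemma dual_witness M (g : seq K) : star_max A star M -> (forall x, x \in g -> M x) ->
  exists u, ~ loc A M A u /\ forall x, x \in g -> loc A M A (u * x).
Proof.
move=> mM; have pM := star_max_prime h mM; have [sM MA _ _] := pM.
have [lA0 lAB] := loc_add hA pM (ring_submodule hA).
elim: g => [_|x g IH hg].
  have [y My y0] : exists2 y, M y & y != 0 by case: (star_max_ideal mM).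
  exists y^-1; split=> // -[s [As ns hs]]; apply: ns.
  by rewrite -(divfK y0 s); case: sM => _ _; apply.
have [|u [nu hu]] := IH; first by move=> y yg; apply: hg; rewrite inE yg orbT.
have Mx : M x by apply: hg; rewrite inE eqxx.
have u0 : u != 0 by apply/eqP => e; apply: nu; rewrite e.
have ui0 : u^-1 != 0 by rewrite invr_eq0.
have [n hn] := star_max_arch h hdim mM Mx ui0; rewrite invrK in hn.
have [k [nk hk]] : exists k, ~ loc A M A (x ^+ k * u) /\ loc A M A (x ^+ k.+1 * u).
  apply: contrapT => hno; suff : ~ loc A M A (x ^+ n * u) by apply.
  elim: {hn} n => [|n IHn]; first by rewrite mul1r.
  by move=> hn; apply: hno; exists n.
exists (x ^+ k * u); split=> // y; rewrite inE => /orP[/eqP ->|yg].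
  by rewrite mulrAC -exprSr.
rewrite -mulrA; apply: (locZ hA pM (ring_submodule hA)); last exact: hu.
by apply: (sub_loc hA pM); apply: subringX => //; apply: MA.
Qed.

(** An element of [v_op J] outside [M] would bring the multiplier [u] of [dual_witness] into the
    localized ring. *)
Lemma star_max_t_ideal M : star_max A star M -> t_op A M = M.
Proof.
move=> mM; have pM := star_max_prime h mM; have [sM MA _ _] := pM.
have iM := star_max_ideal mM; have [[[_ eM] _ _] _] := mM.
rewrite predeqE => x; split; last by rewrite -{1}eM; apply: star_sub_t.
move=> [J [fJ JM] Jx].
have Ax : A x by rewrite -[x]mulr1; apply: Jx => y /JM /MA; rewrite mul1r.
apply: contrapT => nx.
have [n [g [hg eJ]]] := fg_idealP fJ.
have [y /mapP[i _ ->]|u [nu hu]] := @dual_witness M [seq g i | i <- enum 'I_n] mM.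
  by apply: JM; rewrite eJ; apply: span_gen.
have [|s [As ns hs]] := loc_common hA pM (ring_submodule hA) (x := fun i => u * g i).
  by move=> i; apply: hu; apply: map_f; rewrite mem_enum.
apply: nu; exists (x * s); split; [exact: AM|exact: (primeM pM)|].
rewrite -mulrA; apply: Jx => y; rewrite eJ => -[c Ac ->].
rewrite mulr_sumr; under eq_bigr => i _ do rewrite mulrCA -mulrA.
exact: (submodule_sum hA (ring_submodule hA)).
Qed.

(** Ideals closed for [t] are closed for [star]; the reverse is used at star-maximal ideals, where
    dimension one supplies it. *)
Lemma star_max_t : star_max A (t_op A) = star_max A star.
Proof.
have t_star I : proper_integral_star_ideal A (t_op A) I ->
    proper_integral_star_ideal A star I.
  move=> [[iI eI] IA InA]; split=> //; split=> //.
  rewrite predeqE => x; split; last exact: (star_extensive hS iI).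
  by rewrite -{2}eI; apply: star_sub_t.
have star_t M : star_max A star M -> star_max A (t_op A) M.
  move=> mM; have [[[iM _] MA MnA] Mmax] := mM.
  split; first by split=> //; split=> //; apply: star_max_t_ideal.
  by move=> I /t_star; apply: Mmax.
rewrite predeqE => P; split; last exact: star_t.
move=> [tP Pmax]; have [[iP eP] PA PnA] := t_star P tP.
suff [M mM PM] : exists2 M, star_max A star M & P `<=` M.
  by have [tM _] := star_t M mM; rewrite -(Pmax M tM PM).
apply: contrapT => hn; apply: PnA; rewrite predeqE => x; split; first exact: PA.
have [[_ _ PZ] _ _] := iP.
suff P1 : P 1 by move=> Ax; rewrite -[x]mulr1; apply: PZ.
rewrite -eP; apply/(starE h _ iP) => M mM; apply: contrapT => h1; apply: hn.
exists M => // p Pp; apply: contrapT => np; apply: h1; exists p.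
by rewrite mulr1; split=> //; apply: PA.
Qed.

Lemma star_eq_w : star_eq A star (w_op A).
Proof.
move=> I iI; rewrite (setting_tilde h iI) /w_op /star_tilde.
by rewrite star_max_t.
Qed.

Lemma intclosure_w : star_integral_closure A (w_op A) = D.
Proof.
rewrite predeqE => x; split=> -[J fJ hx]; exists J => //; have [iJ _] := fJ.
  by move: hx; rewrite -(star_eq_w iJ).
by rewrite -(star_eq_w iJ).
Qed.

(** By duality a multiplier of [star J] also multiplies [v_op J]; conversely [colon_krull] applies
    to the divisorial ideal. *)
Lemma intclosure_complete : krull_domain D -> D = complete_integral_closure A.
Proof.
move=> [_ _ [L [v [dv eD _]]]]; rewrite predeqE => x; split.
  move=> [J fJ hx]; have [iJ _] := fJ; exists J => // y Jy u hu.
  rewrite mulrAC mulrC; apply: Jy => z Jz; rewrite mulrAC.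
  by apply: (star_sub_v iJ) hu; apply: hx; apply: (star_extensive hS iJ).
move=> [J iJ hx]; apply: (colon_krull h dv eD _ hx).
by do 2?[apply: (colon_ideal hA hK) => //]; exact: ring_ideal.
Qed.

End WOperation.

(** * The fraction field as ambient field, and the equivalence *)

Lemma base_ring_subring (R : idomainType) : subring (base_ring R).
Proof.
split; first by exists 1; rewrite // rmorph1.
- by move=> _ _ [a _ <-] [b _ <-]; exists (a - b); rewrite // rmorphB.
- by move=> _ _ [a _ <-] [b _ <-]; exists (a * b); rewrite // rmorphM.
Qed.

Lemma base_ring_frac (R : idomainType) (x : {fraction R}) : exists a b,
  [/\ base_ring R a, base_ring R b, b != 0 & x = a / b].
Proof.
elim/quotW: x => r; pose n := (frac r).1; pose d := (frac r).2.
have d0 : d != 0 by exact: denom_ratioP.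
have d0' : FracField.tofrac d != 0 by rewrite tofrac_eq0.
exists (FracField.tofrac n), (FracField.tofrac d); split=> //; [by exists n|by exists d|].
apply: (mulIf d0'); rewrite divfK //.
rewrite -[LHS]/(FracField.mul _ _) !piE; apply/eqmodP.
rewrite /= FracField.equivfE /FracField.mulf !numden_Ratio ?mulf_neq0 ?oner_eq0 //.
by rewrite !mulr1 mulrC.
Qed.

Theorem theorem4p8 (R : idomainType)
    (star : set {fraction R} -> set {fraction R})
    (hstar : star_operation (base_ring R) star)
    (htilde : star_eq (base_ring R) star (star_tilde (base_ring R) star))
    (hspectral : spectral (base_ring R) star)
    (hfinite : finite_type (base_ring R) star) :
  (clifford_star_regular (base_ring R) star /\
     krull_domain (star_integral_closure (base_ring R) star)
   <->
   star_stable (base_ring R) star /\ star_dimension_one (base_ring R) star)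
  /\
  ((clifford_star_regular (base_ring R) star /\
      krull_domain (star_integral_closure (base_ring R) star)) \/
   (star_stable (base_ring R) star /\ star_dimension_one (base_ring R) star) ->
   [/\ star_eq (base_ring R) star (w_op (base_ring R)),
       star_integral_closure (base_ring R) star
         = star_integral_closure (base_ring R) (w_op (base_ring R))
     & star_integral_closure (base_ring R) (w_op (base_ring R))
         = complete_integral_closure (base_ring R)]).
Proof.
have h : spectral_setting (base_ring R) star.
  by split=> //; [exact: base_ring_subring|exact: base_ring_frac].
have i_ii : clifford_star_regular (base_ring R) star /\
     krull_domain (star_integral_closure (base_ring R) star) ->
   star_stable (base_ring R) star /\ star_dimension_one (base_ring R) star.
  move=> [hreg [_ _ [L [v [dv eD fin]]]]]; split.
    exact: (@regular_krull_stable _ _ _ h hreg _ _ dv eD fin).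
  exact: (@regular_krull_dim1 _ _ _ h hreg _ _ dv eD fin).
split.
  split=> // -[hst hdim]; split; first exact: (@stable_regular _ _ _ h hst).
  exact: (stable_dim1_krull h hst hdim).
(* Either alternative yields stability and dimension one, from which all conclusions about [w]
   follow. *)
move=> hor.
have [hst hdim] : star_stable (base_ring R) star /\ star_dimension_one (base_ring R) star.
  by case: hor.
have hk := stable_dim1_krull h hst hdim.
split; first exact: (@star_eq_w _ _ _ h hdim).
  by rewrite (intclosure_w h hdim).
by rewrite (intclosure_w h hdim); exact: (intclosure_complete h hk).
Qed.
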